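(* Let $k$ be a field, let $k\mathcal{T}=\bigoplus_{n\ge 0}k\mathcal{T}_n$ be the Hopf algebra of standard heap ordered trees, and let $k\mathfrak{S}=\bigoplus_{n\ge 0}k\mathfrak{S}_n$ be equipped with the heap product $\#$, its unit, the coproduct $\Delta$ and the counit $\epsilon$ (all defined in the context). Let $\varphi:k\mathcal{T}\to k\mathfrak{S}$ be the linear extension of the maps $\varphi:\mathcal{T}_n\to\mathfrak{S}_n$, $n\ge 0$, defined in the context. Then $k\mathfrak{S}$ is a bialgebra, and indeed a Hopf algebra, and $\varphi:k\mathcal{T}\to k\mathfrak{S}$ is a bialgebra isomorphism.
   Context: **Trees.** A standard heap ordered tree on $n+1$ nodes is a finite rooted tree (no planar structure) in which all nodes except the root are labeled with $\{1,\dots,n\}$, each label occurring exactly once, and such that the labels of the children of a labeled node are all larger than the label of that node. $\mathcal{T}_n$ is the set of these trees; $k\mathcal{T}_n$ is the $k$-vector space with basis $\mathcal{T}_n$. $\mathcal{T}_0=\{e\}$, where $e$ is the tree consisting only of the root. A heap ordered tree is a finite rooted tree in which every node, including the root, carries a positive integer label, all labels being distinct, and such that each child has a larger label than its parent. The children of a node are listed from left to right in increasing order of label. ''Children of the root'' also refers to the subtrees rooted at those children. For a tree $t$ with distinct positive integer labels (root labeled or not) whose labels in increasing order are $j_1<\dots<j_k$, $\mathrm{st}(t,m)$ is the tree obtained by replacing each label $j_p$ by $p+m$; put $\mathrm{st}(t)=\mathrm{st}(t,0)$. $\mathrm{B}_-(t)$ is the set of subtrees left after deleting the (unlabeled) root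 of $t$. For a set $\{s_1,\dots,s_r\}$ of heap ordered trees and a tree $t_2$, $\mathrm{A}^+(\{s_1,\dots,s_r\},t_2)$ is the collection of all trees obtained from $t_2$ by making each $s_i$ a child of some node of $t_2$ (root included; different $s_i$ may go to the same node); if $t_2$ has $n+1$ nodes there are $(n+1)^r$ such trees. Product on $k\mathcal{T}$ (extended bilinearly): for $t_1\in\mathcal{T}_m$, $t_2\in\mathcal{T}_n$, $t_1t_2$ is the sum of the trees in $\mathrm{A}^+(\mathrm{B}_-(\mathrm{st}(t_1,n)),t_2)$. The unit is $e$. Coproduct: $\Delta(t)=\sum_{X\subseteq \mathrm{B}_-(t)}\mathrm{st}(\mathrm{A}^+(X,e))\otimes \mathrm{st}(\mathrm{A}^+(\mathrm{B}_-(t)\setminus X,e))$, where $\mathrm{A}^+(X,e)$ is the single tree whose unlabeled root has the elements of $X$ as children. Counit: $\epsilon(e)=1$ and $\epsilon(t)=0$ for every other tree $t$. It is known that this makes $k\mathcal{T}$ a Hopf algebra. **Permutations.** $\mathfrak{S}_n$ is the symmetric group on $\{1,\dots,n\}$ ($\mathfrak{S}_0$ has one element, the empty permutation); $k\mathfrak{S}_n$ is the $k$-vector space with basis $\mathfrak{S}_n$. Permutations are written as products of disjoint cycles, including all 1-cycles for fixed points; $(a_1a_2\cdots a_p)$ sends $a_1\mapsto a_2\mapsto\cdots\mapsto a_p\mapsto a_1$, and $a_1a_2\cdots a_p$ is the associated string. A product of disjoint cycles $(s_1)\cdots(s_r)$ is in standard order if each string $s_i$ begins with its smallest entry and the first entries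 of $s_1,s_2,\dots,s_r$ are decreasing. Every permutation can be written in standard order. Heap product (extended bilinearly): let $\sigma\in\mathfrak{S}_m$, $\tau\in\mathfrak{S}_n$. Replace $\sigma$ by the permutation of $\{n+1,\dots,n+m\}$ sending $n+i$ to $n+\sigma(i)$, and write it in standard order $(s_1)\cdots(s_r)$; write $\tau$ in standard order. There are $n+1$ attachment points: the entries $1,\dots,n$ appearing in the cycles of $\tau$, and one extra point $\circ$. For each choice of an attachment point for each of the $s_i$, form a permutation in $\mathfrak{S}_{m+n}$ as follows: if $s_i$ is assigned to an entry $a$ of $\tau$, the string $s_i$ is inserted directly to the right of $a$ in the cycle of $\tau$ containing $a$; if several strings are assigned to the same entry $a$, they are placed one after another directly to the right of $a$, from left to right in the order in which they occur in the standard order of $\sigma$; if $s_i$ is assigned to $\circ$, the cycle $(s_i)$ is included as a separate factor. Then $\sigma\,\#\,\tau$ is the sum of the resulting $(n+1)^r$ terms. The unit is the empty permutation in $\mathfrak{S}_0$. Coproduct: let $\pi\in\mathfrak{S}_n$ have set of disjoint cycles $C=\{(s_1),\dots,(s_k)\}$ (1-cycles included). For $X\subseteq C$, let $\rho(X)$ be the permutation in $\mathfrak{S}_{\ell}$ obtained from the product of the cycles in $X$ by replacing the $j$-th smallest of the $\ell$ entries occurring in $X$ by $j$, for each $j$. Then $\Delta(\pi)=\sum_{X\subseteq C}\rho(X)\otimes\rho(C\setminus X)$. Counit: $\epsilon(\pi)=1$ if $\pi\in\mathfrak{S}_0$, and $\epsilon(\pi)=0$ otherwise. **The map $\varphi$.**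 For a heap ordered tree $t$ whose root has label $i$ and whose root's children, in increasing order of root label, are the subtrees $t_1,\dots,t_k$, define recursively the string $\alpha(t)=i\,\alpha(t_k)\cdots\alpha(t_1)$ (so $\alpha(t)=i$ if $k=0$). For a standard heap ordered tree $t\in\mathcal{T}_n$ whose root has children $t_1,\dots,t_k$, put $\varphi(t)=(\alpha(t_1))\cdots(\alpha(t_k))\in\mathfrak{S}_n$, a product of disjoint cycles. *)

(* Defs.v *)
From HB Require Import structures.
From mathcomp Require Import all_boot all_order all_algebra all_fingroup.
From mathcomp Require Import finmap zify.
From mathcomp.multinomials Require Import monalg.

Set Implicit Arguments.
Unset Strict Implicit.
Unset Printing Implicit Defensive.

Import GRing.Theory.

Local Open Scope ring_scope.

(* [{malg k[B]}] is the vector space with basis [B], and the tensor product   *)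
(* of [{malg k[B]}] and [{malg k[C]}] is the space with basis [B * C].        *)

Section FreeModules.

Variable k : fieldType.

Definition linext (B : choiceType) (V : lmodType k) (f : B -> V)
  (x : {malg k[B]}) : V := \sum_(b <- msupp x) x@_b *: f b.

Definition linext2 (B C : choiceType) (V : lmodType k) (f : B -> C -> V)
  (x : {malg k[B]}) (y : {malg k[C]}) : V :=
  linext (fun b => linext (f b) y) x.

Definition tensor (B C : choiceType) :
  {malg k[B]} -> {malg k[C]} -> {malg k[(B * C)%type]} :=
  linext2 (fun b c => << (b, c) >>).

Definition tmap (B C B' C' : choiceType)
  (f : {malg k[B]} -> {malg k[B']}) (g : {malg k[C]} -> {malg k[C']}) :
  {malg k[(B * C)%type]} -> {malg k[(B' * C')%type]} :=
  linext (fun p => tensor (f << p.1 >>) (g << p.2 >>)).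

Definition tassoc (B C D : choiceType) :
  {malg k[(B * C * D)%type]} -> {malg k[(B * (C * D))%type]} :=
  linext (fun p => << (p.1.1, (p.1.2, p.2)) >>).

(* The factorisation of a bilinear map through the tensor product. *)
Definition tlift (B C D : choiceType)
  (m : {malg k[B]} -> {malg k[C]} -> {malg k[D]}) :
  {malg k[(B * C)%type]} -> {malg k[D]} :=
  linext (fun p => m << p.1 >> << p.2 >>).

(* (a (x) b) (c (x) d) = ac (x) bd *)
Definition tmul (B : choiceType)
  (m : {malg k[B]} -> {malg k[B]} -> {malg k[B]}) :
  {malg k[(B * B)%type]} -> {malg k[(B * B)%type]} -> {malg k[(B * B)%type]} :=
  linext2 (fun p q =>
    tensor (m << p.1 >> << q.1 >>) (m << p.2 >> << q.2 >>)).

Record bialg_data (B : choiceType) := BialgData {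
  bmul : {malg k[B]} -> {malg k[B]} -> {malg k[B]};
  bone : {malg k[B]};
  bcomul : {malg k[B]} -> {malg k[(B * B)%type]};
  bcounit : {malg k[B]} -> k
}.

Record is_algebra (B : choiceType) (D : bialg_data B) : Prop := {
  bmul_linearl : forall y, linear (fun x => bmul D x y);
  bmul_linearr : forall x, linear (bmul D x);
  bmulA : associative (bmul D);
  bmul1l : left_id (bone D) (bmul D);
  bmul1r : right_id (bone D) (bmul D)
}.

Record is_coalgebra (B : choiceType) (D : bialg_data B) : Prop := {
  bcomul_linear : linear (bcomul D);
  bcounit_linear : scalar (bcounit D);
  bcomulA : forall x,
    tassoc (tmap (bcomul D) id (bcomul D x)) = tmap id (bcomul D) (bcomul D x);
  bcounitl : forall x,
    linext (fun p => bcounit D << p.1 >> *: << p.2 >>) (bcomul D x) = x;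
  bcounitr : forall x,
    linext (fun p => bcounit D << p.2 >> *: << p.1 >>) (bcomul D x) = x
}.

Record is_bialgebra (B : choiceType) (D : bialg_data B) : Prop := {
  bialg_alg : is_algebra D;
  bialg_coalg : is_coalgebra D;
  bcomulM : forall x y,
    bcomul D (bmul D x y) = tmul (bmul D) (bcomul D x) (bcomul D y);
  bcomul1 : bcomul D (bone D) = tensor (bone D) (bone D);
  bcounitM : forall x y, bcounit D (bmul D x y) = bcounit D x * bcounit D y;
  bcounit1 : bcounit D (bone D) = 1
}.

Record is_antipode (B : choiceType) (D : bialg_data B)
  (S : {malg k[B]} -> {malg k[B]}) : Prop := {
  antipode_linear : linear S;
  antipodel : forall x,
    tlift (bmul D) (tmap S id (bcomul D x)) = bcounit D x *: bone D;
  antipoder : forall x,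
    tlift (bmul D) (tmap id S (bcomul D x)) = bcounit D x *: bone D
}.

Definition is_hopf (B : choiceType) (D : bialg_data B) : Prop :=
  is_bialgebra D /\ exists S, is_antipode D S.

Record is_bialg_morphism (B C : choiceType) (D : bialg_data B)
  (E : bialg_data C) (f : {malg k[B]} -> {malg k[C]}) : Prop := {
  bmorph_linear : linear f;
  bmorphM : forall x y, f (bmul D x y) = bmul E (f x) (f y);
  bmorph1 : f (bone D) = bone E;
  bmorph_comul : forall x, bcomul E (f x) = tmap f f (bcomul D x);
  bmorph_counit : forall x, bcounit E (f x) = bcounit D x
}.

Definition is_bialg_isomorphism (B C : choiceType) (D : bialg_data B)
  (E : bialg_data C) (f : {malg k[B]} -> {malg k[C]}) : Prop :=
  is_bialg_morphism D E f /\ bijective f.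

End FreeModules.

(* Throughout, the label set {1, ..., n} is shifted to {0, ..., n-1}, the     *)
(* range of ['I_n].                                                           *)

Local Open Scope nat_scope.

(* The number of entries of [L] below [j]; for [j] in the duplicate-free      *)
(* sequence [L], its (0-based) position in the increasing order.              *)
Definition rank (L : seq nat) (j : nat) : nat := count (ltn^~ j) L.

(* For an assignment [g] of attachment points to the members of [ss], the     *)
(* subsequence of those assigned to [o]; [None] is the extra point (the root  *)
(* of a tree, the point "o" for permutations).                                *)
Definition placed (T : Type) (ss : seq T) (g : seq (option nat))
  (o : option nat) : seq T := [seq p.1 | p <- zip ss g & p.2 == o].

Definition choice_points n r (f : r.-tuple (option 'I_n)) : seq (option nat) :=
  [seq omap val o | o <- f].

Inductive htree := HNode of nat & seq htree.

Fixpoint htree_enc (t : htree) : GenTree.tree void :=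
  let: HNode i ts := t in GenTree.Node i (map htree_enc ts).

Fixpoint htree_dec (t : GenTree.tree void) : htree :=
  match t with
  | GenTree.Leaf _ => HNode 0 [::]
  | GenTree.Node i ts => HNode i (map htree_dec ts)
  end.

Fixpoint htree_all_ind (P : htree -> Prop)
  (IH : forall i ts, (forall t, List.In t ts -> P t) -> P (HNode i ts))
  (t : htree) : P t :=
  let: HNode i ts := t in
  IH i ts ((fix loop (s : seq htree) : forall t, List.In t s -> P t :=
    match s with
    | [::] => fun t (h : False) => match h with end
    | u :: s' => fun t h =>
        match h with
        | or_introl e => eq_ind u P (htree_all_ind IH u) t e
        | or_intror h' => loop s' t h'
        end
    end) ts).

Lemma htree_encK : cancel htree_enc htree_dec.
Proof.
elim/htree_all_ind => i ts IH /=; congr HNode; rewrite -map_comp.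
elim: ts IH => //= t ts IHts IH; rewrite IH; last by left.
by rewrite IHts // => u hu; apply: IH; right.
Qed.

HB.instance Definition _ := Choice.copy htree (can_type htree_encK).

Lemma htree_mem_ind (P : htree -> Prop) :
  (forall i ts, {in ts, forall t, P t} -> P (HNode i ts)) -> forall t, P t.
Proof.
move=> IH; elim/htree_all_ind => i ts IHts; apply: IH => t.
elim: ts IHts => // u ts IHu IHts; rewrite inE => /orP[/eqP-> | tts].
  by apply: IHts; left.
by apply: IHu => // v hv; apply: IHts; right.
Qed.

Definition root (t : htree) : nat := let: HNode i _ := t in i.

Fixpoint labels (t : htree) : seq nat :=
  let: HNode i ts := t in i :: flatten (map labels ts).

(* A tree with unlabelled root is represented by the sequence B_-(t) of the   *)
(* subtrees at the children of the root. The absence of a planar structure is *)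
(* rendered by requiring siblings to be listed in increasing order of label,  *)
(* so that every tree has exactly one representation.                         *)
Fixpoint heap (t : htree) : bool :=
  let: HNode i ts := t in
  [&& all (fun c => i < root c) ts, sorted ltn (map root ts) & all heap ts].

Definition flabels (F : seq htree) : seq nat := flatten (map labels F).

Definition heap_forest (F : seq htree) : bool :=
  [&& sorted ltn (map root F), all heap F & uniq (flabels F)].

Definition std_forest n (F : seq htree) : bool :=
  heap_forest F && perm_eq (flabels F) (iota 0 n).

Definition hotree n := {F : seq htree | std_forest n F}.
HB.instance Definition _ n := Choice.on (hotree n).

Definition forest n (t : hotree n) : seq htree := val t.

Fixpoint relabel (f : nat -> nat) (t : htree) : htree :=
  let: HNode i ts := t in HNode (f i) (map (relabel f) ts).

Definition st (F : seq htree) (m : nat) : seq htree :=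
  map (relabel (fun j => rank (flabels F) j + m)) F.

(* [graft N t] makes the members of [N a] children of the node labelled [a].  *)
(* They are appended to the existing children: in the product below all their *)
(* labels exceed those of [t].                                                *)
Fixpoint graft (N : nat -> seq htree) (t : htree) : htree :=
  let: HNode i ts := t in HNode i (map (graft N) ts ++ N i).

(* The tree of A^+(F1, F2) given by the assignment [g]. *)
Definition attach (F1 : seq htree) (g : seq (option nat)) (F2 : seq htree) :
  seq htree :=
  map (graft (fun a => placed F1 g (Some a))) F2 ++ placed F1 g None.

Lemma homo_in_inj (L : seq nat) (f : nat -> nat) :
  {in L &, {homo f : i j / i < j}} -> {in L &, injective f}.
Proof.
move=> fL i j iL jL fij; case: (ltngtP i j) => // /fL h.
  by have := h iL jL; rewrite fij ltnn.
by have := h jL iL; rewrite fij ltnn.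
Qed.

Lemma labels_relabel f t : labels (relabel f t) = map f (labels t).
Proof.
elim/htree_mem_ind: t => i ts IH /=; congr cons.
rewrite map_flatten -!map_comp; congr flatten.
by apply/eq_in_map => t /IH.
Qed.

Lemma flabels_relabel f F : flabels (map (relabel f) F) = map f (flabels F).
Proof.
rewrite /flabels map_flatten -!map_comp; congr flatten.
by apply/eq_map => t /=; rewrite labels_relabel.
Qed.

Lemma root_relabel f t : root (relabel f t) = f (root t).
Proof. by case: t. Qed.

Lemma root_labels t : root t \in labels t.
Proof. by case: t => i ts; rewrite inE eqxx. Qed.

Lemma mem_flabels t F : t \in F -> {subset labels t <= flabels F}.
Proof. by move=> tF x xt; apply/flattenP; exists (labels t) => //; apply: map_f. Qed.

Lemma sorted_relabel (f : nat -> nat) (F : seq htree) (L : seq nat) :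
  {in L &, {homo f : i j / i < j}} -> {subset flabels F <= L} ->
  sorted ltn (map root F) -> sorted ltn (map root (map (relabel f) F)).
Proof.
move=> fL FL srt; rewrite -map_comp (@eq_map _ _ _ (f \o root) (root_relabel f)).
rewrite map_comp; apply: (homo_sorted_in (P := [in L])) srt => //.
by apply/allP => _ /mapP[t tF ->]; apply/FL/(mem_flabels tF)/root_labels.
Qed.

Lemma heap_relabel (f : nat -> nat) (L : seq nat) t :
  {in L &, {homo f : i j / i < j}} -> {subset labels t <= L} ->
  heap t -> heap (relabel f t).
Proof.
move=> fL; elim/htree_mem_ind: t => i ts IH tL /= /and3P[hi hs hh].
have tsL : {subset flabels ts <= L}.
  by move=> x xt; apply: tL; rewrite /= inE xt orbT.
apply/and3P; split; last 1 first.
- apply/allP => _ /mapP[t tts ->]; apply: IH => //; last exact: (allP hh).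
  by move=> x xt; apply/tsL/(mem_flabels tts).
- apply/allP => _ /mapP[t tts ->]; rewrite root_relabel.
  apply: fL; last exact: (allP hi).
    by apply: tL; rewrite inE eqxx.
  exact/tsL/(mem_flabels tts)/root_labels.
- exact: sorted_relabel fL tsL hs.
Qed.

Lemma heap_forest_relabel (f : nat -> nat) F :
  {in flabels F &, {homo f : i j / i < j}} ->
  heap_forest F -> heap_forest (map (relabel f) F).
Proof.
move=> fF /and3P[hs hh hu]; apply/and3P; split.
- exact: (sorted_relabel fF).
- apply/allP => _ /mapP[t tF ->]; apply: heap_relabel fF _ _.
    exact: mem_flabels.
  exact: (allP hh).
- rewrite flabels_relabel map_inj_in_uniq //; exact: homo_in_inj.
Qed.

Lemma rank_homo (L : seq nat) : {in L &, {homo rank L : i j / i < j}}.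
Proof.
move=> i j iL _ ij; rewrite /rank.
have -> : count (ltn^~ j) L =
          count (ltn^~ i) L + count (fun x => i <= x < j) L.
  rewrite -count_predUI [X in _ + X](_ : _ = 0) ?addn0; last first.
    by rewrite (eq_count (a2 := pred0)) ?count_pred0 // => x /=; lia.
  by apply: eq_count => x /=; lia.
rewrite -[ltnLHS]addn0 ltn_add2l -has_count; apply/hasP; exists i => //=.
by rewrite leqnn.
Qed.

Lemma rank_perm_iota L : uniq L -> perm_eq (map (rank L) L) (iota 0 (size L)).
Proof.
move=> uL; have inj := homo_in_inj (@rank_homo L).
have uR : uniq (map (rank L) L) by rewrite map_inj_in_uniq.
have sub : {subset map (rank L) L <= iota 0 (size L)}.
  move=> _ /mapP[i iL ->]; rewrite mem_iota add0n /= /rank.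
  rewrite -(count_predC (ltn^~ i)) -[ltnLHS]addn0 ltn_add2l -has_count.
  by apply/hasP; exists i => //=; rewrite ltnn.
apply: uniq_perm => //; first exact: iota_uniq.
by have [] := uniq_min_size uR sub; first by rewrite size_iota size_map.
Qed.

Lemma heap_forest_st F m : heap_forest F -> heap_forest (st F m).
Proof.
apply: heap_forest_relabel => i j iF jF ij.
by rewrite ltn_add2r; apply: rank_homo.
Qed.

Lemma std_forest_st F : heap_forest F ->
  std_forest (size (flabels F)) (st F 0).
Proof.
move=> hF; rewrite /std_forest heap_forest_st //= flabels_relabel.
under eq_map do rewrite addn0.
by apply: rank_perm_iota; case/and3P: hF.
Qed.

Lemma flabels_st n (F : seq htree) m :
  std_forest n F -> perm_eq (flabels (st F m)) (iota m n).
Proof.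
case/andP=> /and3P[_ _ uF] pF; rewrite flabels_relabel.
under eq_map do rewrite addnC; rewrite (map_comp (addn m)) -[m in iota m _]addn0.
rewrite iotaDl; apply: perm_map.
by rewrite -[n](size_iota 0) -(perm_size pF); apply: rank_perm_iota.
Qed.

Lemma flabels_cat F1 F2 : flabels (F1 ++ F2) = flabels F1 ++ flabels F2.
Proof. by rewrite /flabels map_cat flatten_cat. Qed.

Lemma count_flabels P F : count P (flabels F) = \sum_(t <- F) count P (labels t).
Proof. by rewrite /flabels count_flatten -map_comp sumnE big_map. Qed.

Lemma count_labels_graft P N t :
  count P (labels (graft N t)) =
  count P (labels t) + \sum_(a <- labels t) count P (flabels (N a)).
Proof.
elim/htree_mem_ind: t => i ts IH.
have -> : labels (graft N (HNode i ts)) =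
          i :: flabels (map (graft N) ts ++ N i) by [].
have -> : labels (HNode i ts) = i :: flabels ts by [].
rewrite /= big_cons flabels_cat count_cat.
rewrite !count_flabels big_map [\sum_(_ <- flabels ts) _]big_flatten big_map.
by rewrite [X in _ + (X + _)](eq_big_seq _ IH) big_split /= [in RHS](addnC (\sum_(_ <- N i) _)) !addnA.
Qed.

Lemma count_attach P F1 g F2 n :
  size g = size F1 -> {subset g <= None :: map Some (iota 0 n)} ->
  perm_eq (flabels F2) (iota 0 n) ->
  count P (flabels (attach F1 g F2)) = count P (flabels F1) + count P (flabels F2).
Proof.
move=> sg gn pF2; rewrite /attach flabels_cat count_cat count_flabels big_map.
under eq_bigr do rewrite count_labels_graft.
rewrite big_split /= -count_flabels -addnA addnC; congr addn.
pose c o := count P (flabels (placed F1 g o)).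
transitivity (\sum_(o <- None :: map Some (iota 0 n)) c o).
  rewrite big_cons big_map addnC; congr addn.
  by rewrite -(perm_big _ pF2) big_flatten big_map.
rewrite count_flabels -[F1 in RHS](@unzip1_zip _ _ F1 g) ?sg // big_map.
under eq_bigr => o _ do rewrite /c count_flabels big_map big_filter.
under eq_bigr => o _ do rewrite big_mkcond.
rewrite exchange_big /= [LHS]big_seq [RHS]big_seq; apply: eq_bigr => p pz.
rewrite -big_mkcond /=.
have uo : uniq (None :: map Some (iota 0 n)).
  rewrite /= map_inj_uniq ?iota_uniq ?andbT; last by move=> ? ? [].
  by apply/mapP => -[].
have po : p.2 \in None :: map Some (iota 0 n).
  apply: gn; rewrite -[g](@unzip2_zip _ _ F1) ?sg //.
  exact: (map_f snd).
rewrite (big_rem p.2 po) eqxx big1_seq; first exact: addn0.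
move=> o /andP[/eqP<-].
by rewrite (mem_rem_uniq _ uo) inE eqxx.
Qed.

Lemma root_graft N t : root (graft N t) = root t.
Proof. by case: t. Qed.

Lemma map_root_graft N F : map root (map (graft N) F) = map root F.
Proof. by rewrite -map_comp; apply: eq_map => t; apply: root_graft. Qed.

Lemma sorted_roots_cat n F N :
  all (gtn n) (map root F) -> all (leq n) (map root N) ->
  sorted ltn (map root F) -> sorted ltn (map root N) ->
  sorted ltn (map root (F ++ N)).
Proof.
move=> Fn Nn; rewrite !(sorted_pairwise ltn_trans) map_cat pairwise_cat => -> ->.
rewrite !andbT; apply/allrelP => i j /(allP Fn) /= ni /(allP Nn) /=.
exact: leq_trans.
Qed.

Lemma heap_graft N n t :
  (forall a, [&& sorted ltn (map root (N a)), all heap (N a) &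
                 all (leq n) (map root (N a))]) ->
  all (gtn n) (labels t) -> heap t -> heap (graft N t).
Proof.
move=> hN; elim/htree_mem_ind: t => i ts IH /= /andP[i_n ts_n] /and3P[hi hs hh].
have /and3P[Ns Nh Nn] := hN i.
have ts_r : all (gtn n) (map root ts).
  apply/allP => _ /mapP[t tts ->].
  by apply: (allP ts_n); apply: (mem_flabels tts); apply: root_labels.
apply/and3P; split.
- rewrite all_cat; apply/andP; split.
    apply/allP => _ /mapP[t tts ->]; rewrite root_graft; exact: (allP hi).
  apply/allP => t tN; apply: (leq_trans i_n).
  by apply: (allP Nn); apply: map_f.
- by apply: (@sorted_roots_cat n); rewrite ?map_root_graft.
- rewrite all_cat Nh andbT; apply/allP => _ /mapP[t tts ->].
  apply: IH => //; last exact: (allP hh).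
  by apply/allP => x xt; apply: (allP ts_n); apply: (mem_flabels tts).
Qed.

Lemma placed_subseq (F : seq htree) g o : subseq (placed F g o) F.
Proof.
rewrite /placed; elim: F g => [|t F IH] [|p g] //=.
case: (p == o) => /=; first by rewrite eqxx.
exact: subseq_trans (IH g) (subseq_cons _ _).
Qed.

Lemma std_forest_attach m n (F1 F2 : seq htree)
  (f : (size F1).-tuple (option 'I_n)) :
  std_forest m F1 -> std_forest n F2 ->
  std_forest (m + n) (attach (st F1 n) (choice_points f) F2).
Proof.
move=> sF1 sF2; have /andP[hF1 _] := sF1.
have /andP[/and3P[F2s F2h _] pF2] := sF2.
have /and3P[Ss Sh Su] := heap_forest_st n hF1; have pS := flabels_st n sF1.
set S := st F1 n in Ss Sh Su pS *; set g := choice_points f.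
have Sn : all (leq n) (map root S).
  apply/allP => _ /mapP[t tS ->].
  have := mem_flabels tS (root_labels t).
  by rewrite (perm_mem pS) mem_iota => /andP[].
have hN o : [&& sorted ltn (map root (placed S g o)), all heap (placed S g o) &
                all (leq n) (map root (placed S g o))].
  have sub := placed_subseq S g o; apply/and3P; split.
  - exact: (subseq_sorted ltn_trans (map_subseq _ sub)).
  - by apply/allP => t /(mem_subseq sub) /(allP Sh).
  - by apply/allP => t /(mem_subseq (map_subseq root sub)) /(allP Sn).
have F2n : all (gtn n) (flabels F2).
  by apply/allP => x; rewrite (perm_mem pF2) mem_iota.
have F2r : all (gtn n) (map root F2).
  apply/allP => _ /mapP[t tF ->]; apply: (allP F2n).
  exact/(mem_flabels tF)/root_labels.
have pA : perm_eq (flabels (attach S g F2)) (iota 0 (m + n)).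
  apply/seq.permP => P; rewrite addnC iotaD add0n count_cat.
  rewrite -(seq.permP pF2) -(seq.permP pS) addnC; apply: count_attach (pF2).
    by rewrite /g /S /st !size_map size_tuple.
  move=> _ /mapP[[a|] _ ->] //=; rewrite inE /=.
  by rewrite (map_f Some) // mem_iota /=.
rewrite /std_forest pA andbT; apply/and3P; split.
- have /and3P[? _ ?] := hN None.
  by apply: (@sorted_roots_cat n); rewrite ?map_root_graft.
- rewrite all_cat; have /and3P[_ -> _] := hN None; rewrite andbT.
  apply/allP => _ /mapP[t tF ->].
  apply: (@heap_graft _ n) => //; last exact: (allP F2h).
  by apply/allP => x xt; apply/(allP F2n)/(mem_flabels tF).
- by rewrite (perm_uniq pA) iota_uniq.
Qed.

Lemma heap_forest_mask b F : heap_forest F -> heap_forest (mask b F).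
Proof.
case/and3P=> Fs Fh Fu; apply/and3P; split.
- exact: (subseq_sorted ltn_trans (map_subseq _ (mask_subseq b F))).
- exact: all_mask.
- apply: subseq_uniq Fu; rewrite /flabels.
  elim: F b {Fs Fh} => [|t F IH] [|[] b] //=; rewrite ?sub0seq //.
    exact: cat_subseq.
  by apply: subseq_trans (IH b) _; apply: suffix_subseq.
Qed.

Definition hotrees := {n : nat & hotree n}.
HB.instance Definition _ := Choice.on hotrees.

Definition mk_hotree n F (stdF : std_forest n F) : hotrees :=
  Tagged hotree (exist _ F stdF : hotree n).

Definition st_hotree F (hF : heap_forest F) : hotrees :=
  mk_hotree (std_forest_st hF).

Lemma heap_forest_hotree n (t : hotree n) : heap_forest (forest t).
Proof. by case/andP: (valP t). Qed.

Lemma std_forest_nil : std_forest 0 [::].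
Proof. by []. Qed.

(* The tree e consisting only of the root. *)
Definition tree_e : hotrees := mk_hotree std_forest_nil.

Section TreeHopf.

Variable k : fieldType.

Local Open Scope ring_scope.

Definition tree_mul m n (t1 : hotree m) (t2 : hotree n) : {malg k[hotrees]} :=
  \sum_(f : (size (forest t1)).-tuple (option 'I_n))
    << mk_hotree (std_forest_attach f (valP t1) (valP t2)) >>.

(* Subsets of B_-(t) are given by their masks. *)
Definition tree_comul n (t : hotree n) : {malg k[(hotrees * hotrees)%type]} :=
  \sum_(X : (size (forest t)).-tuple bool)
    << (st_hotree (heap_forest_mask X (heap_forest_hotree t)),
        st_hotree (heap_forest_mask (map negb X) (heap_forest_hotree t))) >>.

Definition kT : bialg_data k hotrees := {|
  bmul := linext2 (fun t1 t2 : hotrees => tree_mul (tagged t1) (tagged t2));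
  bone := << tree_e >>;
  bcomul := linext (fun t : hotrees => tree_comul (tagged t));
  bcounit := linext (fun t : hotrees => (t == tree_e)%:R : k^o)
|}.

End TreeHopf.

(* The cycle of the string [s]; [undup] has no effect on the duplicate-free   *)
(* strings to which this is applied, and makes the definition total.          *)
Definition cycle_perm n (s : seq 'I_n) : 'S_n :=
  perm (can_inj (prev_next (undup_uniq s))).

(* All entries of the strings [ss] to which this is applied are below [n]. *)
Definition perm_of_cycles n (ss : seq (seq nat)) : 'S_n :=
  (\prod_(s <- ss) cycle_perm (pmap insub s))%g.

(* The strings of the cycles of [p] in standard order. *)
Definition std_cycles n (p : 'S_n) : seq (seq nat) :=
  [seq map val (traject p a #|porbit p a|)
  | a : 'I_n <- rev (enum 'I_n) & [forall b in porbit p a, a <= b]].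

(* The cycles obtained from the assignment [g] of the strings [ss1] to the    *)
(* entries of the strings [ss2] and the extra point.                          *)
Definition insert_strings (ss1 : seq (seq nat)) (g : seq (option nat))
  (ss2 : seq (seq nat)) : seq (seq nat) :=
  [seq flatten [seq a :: flatten (placed ss1 g (Some a)) | a <- s] | s <- ss2]
  ++ placed ss1 g None.

Definition perms := {n : nat & 'S_n}.
HB.instance Definition _ := Choice.on perms.

Definition mk_perm n (p : 'S_n) : perms := Tagged (fun n => 'S_n) p.

Definition st_cycles (ss : seq (seq nat)) : perms :=
  mk_perm (perm_of_cycles (size (flatten ss))
    [seq map (rank (flatten ss)) s | s <- ss]).

Section PermHopf.

Variable k : fieldType.

Local Open Scope ring_scope.

Definition heap_mul m n (s : 'S_m) (t : 'S_n) : {malg k[perms]} :=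
  let ss := [seq map (addn n) c | c <- std_cycles s] in
  \sum_(f : (size ss).-tuple (option 'I_n))
    << mk_perm (perm_of_cycles (m + n)
         (insert_strings ss (choice_points f) (std_cycles t))) >>.

Definition perm_comul n (p : 'S_n) : {malg k[(perms * perms)%type]} :=
  \sum_(X : (size (std_cycles p)).-tuple bool)
    << (st_cycles (mask X (std_cycles p)),
        st_cycles (mask (map negb X) (std_cycles p))) >>.

Definition kS : bialg_data k perms := {|
  bmul := linext2 (fun s t : perms => heap_mul (tagged s) (tagged t));
  bone := << mk_perm (1%g : 'S_0) >>;
  bcomul := linext (fun p : perms => perm_comul (tagged p));
  bcounit := linext (fun p : perms => (tag p == 0%N)%:R : k^o)
|}.

End PermHopf.

Fixpoint alpha (t : htree) : seq nat :=
  let: HNode i ts := t in i :: flatten (rev (map alpha ts)).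

Definition phi_tree n (t : hotree n) : 'S_n :=
  perm_of_cycles n (map alpha (forest t)).

Definition phi (k : fieldType) : {malg k[hotrees]} -> {malg k[perms]} :=
  linext (fun t : hotrees => << mk_perm (phi_tree (tagged t)) >>%R).
Arguments phi : clear implicits.

(* Main.v *)
(** Every basis element of either side is the standardisation [e F] of a heap
    ordered forest [F] with arbitrary distinct labels. Since the labels may be
    shifted freely, the product of [e F1] and [e F2] is the sum of [e] of the
    forests obtained by attaching [F1] to [F2], as soon as all labels of [F1]
    exceed those of [F2], and the coproduct of [e F] is the sum over all ways of
    splitting [F] in two. Associativity then says that two successive choices of
    attachment points are a single choice, and multiplicativity of the coproduct
    that an attached forest is split by splitting both forests first; both are
    inductions on [F1]. The antipode is obtained recursively, the left and right
    convolution inverses of the identity being equal by associativity.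
    For permutations, [e F] is read off the strings [alpha t], which are the
    standard strings of the permutation; a string is turned back into a tree by
    making each entry the parent of the trees with larger roots found just to
    its right. *)

Require Import Defs.
From mathcomp Require Import all_boot all_order all_algebra all_fingroup.
From mathcomp Require Import finmap zify.
From mathcomp.multinomials Require Import monalg.
(* So that [root] is the one of trees, not that of polynomials. *)
Import Defs.

Set Implicit Arguments.
Unset Strict Implicit.
Unset Printing Implicit Defensive.

Import GRing.Theory.

(** * Linear extension *)

Section LinearExtension.

Local Open Scope ring_scope.

Variable k : fieldType.

Section LinearMaps.

Variables (U V : lmodType k) (f : U -> V).
Hypothesis fL : linear f.

(** The sums of the statement run over tuples of points and over masks whose lengths depend on a
    forest, and the parts of a cut standard forest need not be standard. The first obstacle is met
    by sums defined by recursion on lists, [assign_sum] and [split_sum], which are split and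
    interchanged without dependent types. The second is met by the record [forest_model]: it
    isolates what the argument needs of either structure, so that everything is proved once, for
    heap forests with arbitrary labels, and [phi] becomes the identity on forests. On the side of
    permutations there remains a mismatch of orders: siblings increase, whereas standard order lists
    cycles by decreasing first entry. Lists of strings therefore occur reversed, and the commutation
    of disjoint cycles absorbs the difference. *)

Lemma linfunD x y : f (x + y) = f x + f y.
Proof. by have := fL 1 x y; rewrite !scale1r. Qed.

Lemma linfun0 : f 0 = 0.
Proof. by apply: (addrI (f 0)); rewrite -linfunD !addr0. Qed.

Lemma linfunZ a x : f (a *: x) = a *: f x.
Proof. by have := fL a x 0; rewrite linfun0 !addr0. Qed.

Lemma linfun_sum I (r : seq I) (P : pred I) (F : I -> U) :
  f (\sum_(i <- r | P i) F i) = \sum_(i <- r | P i) f (F i).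
Proof. exact: (big_morph f linfunD linfun0). Qed.

End LinearMaps.

Lemma linear_comp (U V W : lmodType k) (f : V -> W) (g : U -> V) :
  linear f -> linear g -> linear (fun x => f (g x)).
Proof. by move=> fL gL a x y; rewrite gL fL. Qed.

Lemma linear_sum_fun (U V : lmodType k) I (r : seq I) (F : I -> U -> V) :
  (forall i, linear (F i)) -> linear (fun x => \sum_(i <- r) F i x).
Proof.
move=> FL a x y; rewrite scaler_sumr -big_split; apply: eq_bigr => i _.
by rewrite FL.
Qed.

Lemma linear_scale_fun (U V : lmodType k) c (f : U -> V) :
  linear f -> linear (fun x => c *: f x).
Proof. by move=> fL a x y; rewrite fL scalerDr !scalerA mulrC. Qed.

(** Scalars are typed in [k^o], the field as a module over itself, so that a counit counts as a
    linear map. *)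
Lemma linear_scale_const (U V : lmodType k) (g : U -> k^o) (v : V) :
  linear g -> linear (fun x => g x *: v).
Proof. by move=> gL a x y; rewrite gL scalerDl scalerA. Qed.

Lemma linear_id (U : lmodType k) : linear (@id U).
Proof. by []. Qed.

Section Basis.

Variables (B : choiceType) (V : lmodType k).

(** Coefficients outside the support vanish. Linearity needs this to put [x], [y] and [a *: x + y]
    over one index set. *)
Lemma linextE (f : B -> V) (x : {malg k[B]}) (d : {fset B}) :
  (msupp x `<=` d)%fset -> linext f x = \sum_(b <- d) x@_b *: f b.
Proof.
move=> xd; rewrite /linext; apply: big_fset_incl => //= b _.
by move/mcoeff_outdom ->; rewrite scale0r.
Qed.

Lemma linext_linear (f : B -> V) : linear (linext f).
Proof.
move=> a x y; set d := (msupp x `|` msupp y)%fset.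
have xyd : (msupp (a *: x + y) `<=` d)%fset.
  apply: (fsubset_trans (msuppD_le _ _)); apply: fsetUSS => //.
  exact: msuppZ_le.
rewrite (linextE _ xyd) (linextE f (fsubsetUl _ _ : (msupp x `<=` d)%fset)).
rewrite (linextE f (fsubsetUr _ _ : (msupp y `<=` d)%fset)).
rewrite scaler_sumr -big_split; apply: eq_bigr => b _.
by rewrite mcoeffD mcoeffZ scalerDl scalerA.
Qed.

Lemma linext_basis (f : B -> V) b : linext f << b >> = f b.
Proof.
by rewrite /linext msuppU oner_eq0 big_seq_fset1 mcoeffUU scale1r.
Qed.

Lemma malg_basisE (x : {malg k[B]}) :
  x = \sum_(b <- msupp x) x@_b *: << b >>.
Proof.
rewrite {1}[x]monalgE; apply: eq_bigr => b _.
by apply/malgP => c; rewrite mcoeffZ !mcoeffU mulrnAr mulr1.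
Qed.

Lemma linear_eq_basis (f g : {malg k[B]} -> V) :
  linear f -> linear g -> (forall b, f << b >> = g << b >>) -> f =1 g.
Proof.
move=> fL gL fg x; rewrite [x]malg_basisE !linfun_sum //.
by apply: eq_bigr => b _; rewrite !linfunZ // fg.
Qed.

End Basis.

Lemma linext_linear_arg (B : choiceType) (U V : lmodType k) (f : B -> U -> V) x :
  (forall b, linear (f b)) -> linear (fun y => linext (f^~ y) x).
Proof. by move=> fL; apply: linear_sum_fun => b; apply: linear_scale_fun. Qed.

Section Bilinear.

Variables (B C : choiceType) (V : lmodType k) (f : B -> C -> V).

Lemma linext2_linearl y : linear (fun x => linext2 f x y).
Proof. exact: linext_linear. Qed.

Lemma linext2_linearr x : linear (linext2 f x).
Proof. by apply: linext_linear_arg => b; apply: linext_linear. Qed.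

Lemma linext2_basis b c : linext2 f << b >> << c >> = f b c.
Proof. by rewrite /linext2 !linext_basis. Qed.

End Bilinear.

Section Tensor.

Variables (B C D : choiceType).

Lemma tensor_linearl y : linear (fun x : {malg k[B]} => @tensor k B C x y).
Proof. exact: linext2_linearl. Qed.

Lemma tensor_linearr x : linear (@tensor k B C x).
Proof. exact: linext2_linearr. Qed.

Lemma tensor_basis b c : @tensor k B C << b >> << c >> = << (b, c) >>.
Proof. exact: linext2_basis. Qed.

Lemma tmap_linear (B' C' : choiceType)
  (f : {malg k[B]} -> {malg k[B']}) (g : {malg k[C]} -> {malg k[C']}) :
  linear (tmap f g).
Proof. exact: linext_linear. Qed.

Lemma tmap_basis (B' C' : choiceType)
    (f : {malg k[B]} -> {malg k[B']}) (g : {malg k[C]} -> {malg k[C']}) b c :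
  tmap f g << (b, c) >> = tensor (f << b >>) (g << c >>).
Proof. exact: linext_basis. Qed.

Lemma tassoc_linear : linear (@tassoc k B C D).
Proof. exact: linext_linear. Qed.

Lemma tassoc_basis b c d :
  @tassoc k B C D << (b, c, d) >> = << (b, (c, d)) >>.
Proof. exact: linext_basis. Qed.

Lemma tlift_linear (m : {malg k[B]} -> {malg k[C]} -> {malg k[D]}) :
  linear (tlift m).
Proof. exact: linext_linear. Qed.

Lemma tlift_basis (m : {malg k[B]} -> {malg k[C]} -> {malg k[D]}) b c :
  tlift m << (b, c) >> = m << b >> << c >>.
Proof. exact: linext_basis. Qed.

Lemma tlift_tensor (m : {malg k[B]} -> {malg k[C]} -> {malg k[D]}) x y :
  (forall y, linear (m^~ y)) -> (forall x, linear (m x)) ->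
  tlift m (tensor x y) = m x y.
Proof.
move=> ml mr; move: x.
apply: linear_eq_basis => [||b]; last move: y; first 1 last.
- exact: ml.
- apply: linear_eq_basis => [||c]; last by rewrite tensor_basis tlift_basis.
    exact: (linear_comp (@tlift_linear m) (@tensor_linearr _)).
  exact: mr.
- exact: (linear_comp (@tlift_linear m) (@tensor_linearl _)).
Qed.

End Tensor.

Lemma tmul_linearl B m y : linear (fun x => @tmul k B m x y).
Proof. exact: linext2_linearl. Qed.

Lemma tmul_linearr B m x : linear (@tmul k B m x).
Proof. exact: linext2_linearr. Qed.

Lemma tmul_basis (B : choiceType) m (a b c d : B) :
  @tmul k B m << (a, b) >> << (c, d) >> =
  tensor (m << a >> << c >>) (m << b >> << d >>).
Proof. exact: linext2_basis. Qed.

End LinearExtension.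

Lemma big_tuple0 (V : nmodType) (T : finType) (G : seq T -> V) :
  (\sum_(X : 0.-tuple T) G X = G [::])%R.
Proof.
rewrite (big_pred1 [tuple]) // => X; rewrite [X]tuple0; exact/esym/eqP.
Qed.

(** [G] takes a sequence rather than a tuple, so that recursion on the length leaves no dependent
    type behind. *)
Lemma big_tupleS (V : nmodType) (T : finType) n (G : seq T -> V) :
  (\sum_(X : n.+1.-tuple T) G X = \sum_(x : T) \sum_(X : n.-tuple T) G (x :: X))%R.
Proof.
rewrite pair_big /=.
rewrite (reindex (fun p : T * n.-tuple T => [tuple of p.1 :: p.2])) //=.
exists (fun X : n.+1.-tuple T => (thead X, [tuple of behead X])).
  by move=> [x X] _ /=; congr pair; apply: val_inj.
by move=> X _; rewrite /= [RHS]tuple_eta; apply: val_inj.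
Qed.

(** * Sums over assignments and splittings *)

Section AssignmentSums.

Local Open Scope ring_scope.

(** The counterpart of [placed] for an assignment already zipped with its members: such lists of
    pairs can be filtered and concatenated. *)
Definition place (T : Type) (ps : seq (T * option nat)) (o : option nat) :=
  [seq p.1 | p <- ps & p.2 == o].

Lemma place_cat (T : Type) (ps qs : seq (T * option nat)) o :
  place (ps ++ qs) o = place ps o ++ place qs o.
Proof. by rewrite /place filter_cat map_cat. Qed.

(** Replaces the sum over tuples of points; [H] receives an assignment as the list of its pairs, in
    the order of [ss]. *)
Fixpoint assign_sum (T : Type) (V : nmodType) (ss : seq T)
    (pts : seq (option nat)) (H : seq (T * option nat) -> V) : V :=
  if ss is s :: ss' then
    \sum_(o <- pts) assign_sum ss' pts (fun ps => H ((s, o) :: ps))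
  else H [::].

(** Replaces the sum over masks; both parts keep the order of [ss]. *)
Fixpoint split_sum (T : Type) (V : nmodType) (ss : seq T)
    (H : seq T -> seq T -> V) : V :=
  if ss is s :: ss' then
    split_sum ss' (fun a b => H (s :: a) b) + split_sum ss' (fun a b => H a (s :: b))
  else H [::] [::].

Section Generic.

Variables (T : Type) (V : nmodType).
Implicit Types (ss : seq T) (pts : seq (option nat)).

(** The two facts about [ps] are what remains of the tuple type: they tell which trees are attached
    and that every point is legitimate. *)
Lemma eq_assign_sum ss pts (H H' : seq (T * option nat) -> V) :
  (forall ps, unzip1 ps = ss -> {subset unzip2 ps <= pts} -> H ps = H' ps) ->
  assign_sum ss pts H = assign_sum ss pts H'.
Proof.
elim: ss H H' => [|s ss IH] H H' HH /=; first exact: HH.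
apply: eq_big_seq => o opts; apply: IH => ps ps1 ps2; apply: HH.
  by rewrite /= ps1.
by move=> p; rewrite inE => /orP[/eqP->|/ps2].
Qed.

Lemma assign_sum_cat ss1 ss2 pts (H : seq (T * option nat) -> V) :
  assign_sum (ss1 ++ ss2) pts H =
  assign_sum ss1 pts (fun ps => assign_sum ss2 pts (fun qs => H (ps ++ qs))).
Proof. by elim: ss1 H => //= s ss1 IH H; apply: eq_bigr => o _; rewrite IH. Qed.

Lemma assign_sum_map (T' : Type) (f : T' -> T) (ss : seq T') pts
    (H : seq (T * option nat) -> V) :
  assign_sum (map f ss) pts H =
  assign_sum ss pts (fun ps => H [seq (f p.1, p.2) | p <- ps]).
Proof. by elim: ss H => //= s ss IH H; apply: eq_bigr => o _; rewrite IH. Qed.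

Lemma assign_sum_map_pts h ss pts (H : seq (T * option nat) -> V) :
  assign_sum ss (map h pts) H =
  assign_sum ss pts (fun ps => H [seq (p.1, h p.2) | p <- ps]).
Proof.
elim: ss H => //= s ss IH H; rewrite big_map.
by apply: eq_bigr => o _; rewrite IH.
Qed.

Lemma perm_assign_sum ss pts pts' (H : seq (T * option nat) -> V) :
  perm_eq pts pts' -> assign_sum ss pts H = assign_sum ss pts' H.
Proof.
move=> pp; elim: ss H => //= s ss IH H; rewrite (perm_big _ pp).
by apply: eq_bigr => o _; rewrite IH.
Qed.

Lemma assign_sum_big I (r : seq I) ss pts (H : I -> seq (T * option nat) -> V) :
  assign_sum ss pts (fun ps => \sum_(i <- r) H i ps) =
  \sum_(i <- r) assign_sum ss pts (H i).
Proof.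
elim: ss H => //= s ss IH H; rewrite exchange_big; apply: eq_bigr => o _.
by rewrite IH.
Qed.

Lemma assign_sumD ss pts (H H' : seq (T * option nat) -> V) :
  assign_sum ss pts (fun ps => H ps + H' ps) =
  assign_sum ss pts H + assign_sum ss pts H'.
Proof.
elim: ss H H' => //= s ss IH H H'; rewrite -big_split; apply: eq_bigr => o _.
by rewrite IH.
Qed.

Lemma assign_sum_rcons s ss pts (H : seq (T * option nat) -> V) :
  assign_sum (rcons ss s) pts H =
  \sum_(o <- pts) assign_sum ss pts (fun ps => H (rcons ps (s, o))).
Proof.
rewrite -cats1 assign_sum_cat /= -assign_sum_big.
by apply: eq_assign_sum => ps _ _; apply: eq_bigr => o _; rewrite cats1.
Qed.

Lemma assign_sum_rev ss pts (H : seq (T * option nat) -> V) :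
  assign_sum (rev ss) pts H = assign_sum ss pts (fun ps => H (rev ps)).
Proof.
elim: ss H => //= s ss IH H; rewrite rev_cons assign_sum_rcons.
apply: eq_bigr => o _; rewrite IH.
by apply: eq_assign_sum => ps _ _; rewrite rev_cons.
Qed.

Lemma exchange_assign_sum (T' : Type) (ss' : seq T') pts' ss pts
    (H : seq (T * option nat) -> seq (T' * option nat) -> V) :
  assign_sum ss pts (fun ps => assign_sum ss' pts' (H ps)) =
  assign_sum ss' pts' (fun qs => assign_sum ss pts (H^~ qs)).
Proof.
elim: ss' H => //= s ss' IH H; rewrite assign_sum_big.
by apply: eq_bigr => o _; rewrite IH.
Qed.

(** The bridge from the tuples of the statement to the recursive sum. *)
Lemma big_choice_points n ss (H : seq (T * option nat) -> V) :
  \sum_(f : (size ss).-tuple (option 'I_n)) H (zip ss (choice_points f)) =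
  assign_sum ss (None :: map Some (iota 0 n)) H.
Proof.
have pE : None :: map Some (iota 0 n) = map (omap val) (enum {: option 'I_n}).
  rewrite (_ : enum _ = None :: map Some (enum 'I_n)).
    by rewrite -val_enum_ord /= -!map_comp.
  by rewrite !enumT [in LHS]unlock.
move: (None :: _) pE => pts pE; elim: ss H => [|s ss IH] H /=.
  by rewrite (big_tuple0 (fun f : seq (option 'I_n) =>
    H (zip [::] [seq omap val o | o <- f]))).
rewrite (@big_tupleS _ _ _ (fun f : seq (option 'I_n) =>
  H (zip (s :: ss) [seq omap val o | o <- f]))).
rewrite {1}pE big_map big_enum /=; apply: eq_bigr => o _.
exact: (IH (fun ps => H ((s, omap val o) :: ps))).
Qed.

Lemma split_sum_cat ss1 ss2 (H : seq T -> seq T -> V) :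
  split_sum (ss1 ++ ss2) H =
  split_sum ss1 (fun a b => split_sum ss2 (fun c d => H (a ++ c) (b ++ d))).
Proof. by elim: ss1 H => //= s ss1 IH H; rewrite !IH. Qed.

Lemma split_sum_ext ss (H H' : seq T -> seq T -> V) :
  (forall a b, H a b = H' a b) -> split_sum ss H = split_sum ss H'.
Proof.
elim: ss H H' => //= s ss IH H H' HH.
by congr (_ + _); apply: IH => a b; apply: HH.
Qed.

Lemma split_sum_map (T' : Type) (f : T' -> T) (ss : seq T') (H : seq T -> seq T -> V) :
  split_sum (map f ss) H = split_sum ss (fun a b => H (map f a) (map f b)).
Proof. by elim: ss H => //= s ss IH H; rewrite !IH. Qed.

Lemma split_sumD ss (H H' : seq T -> seq T -> V) :
  split_sum ss (fun a b => H a b + H' a b) = split_sum ss H + split_sum ss H'.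
Proof. by elim: ss H H' => //= s ss IH H H'; rewrite !IH addrACA. Qed.

Lemma split_sum_rev ss (H : seq T -> seq T -> V) :
  split_sum (rev ss) H = split_sum ss (fun a b => H (rev a) (rev b)).
Proof.
elim: ss H => //= s ss IH H; rewrite rev_cons -cats1 split_sum_cat IH /=.
rewrite split_sumD; congr (_ + _); apply: split_sum_ext => a b.
  by rewrite rev_cons cats1 cats0.
by rewrite rev_cons cats1 cats0.
Qed.

(** Both sides run over the distributions of [ss] among three ordered parts; this is
    coassociativity. *)
Lemma split_sumA ss (H : seq T -> seq T -> seq T -> V) :
  split_sum ss (fun a b => split_sum a (fun c d => H c d b)) =
  split_sum ss (fun a b => split_sum b (fun c d => H a c d)).
Proof.
elim: ss H => //= s ss IH H; rewrite !split_sumD -addrA; congr (_ + (_ + _)).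
- exact: (IH (fun c d b => H (s :: c) d b)).
- exact: (IH (fun c d b => H c (s :: d) b)).
- exact: (IH (fun c d b => H c d (s :: b))).
Qed.

Lemma exchange_assign_split_sum (T' : Type) (ss' : seq T') ss pts
    (H : seq (T * option nat) -> seq T' -> seq T' -> V) :
  assign_sum ss pts (fun ps => split_sum ss' (H ps)) =
  split_sum ss' (fun a b => assign_sum ss pts (fun ps => H ps a b)).
Proof. by elim: ss' H => //= s ss' IH H; rewrite assign_sumD !IH. Qed.

Lemma big_masks ss (H : seq T -> seq T -> V) :
  \sum_(X : (size ss).-tuple bool) H (mask X ss) (mask (map negb X) ss) =
  split_sum ss H.
Proof.
elim: ss H => [|s ss IH] H /=.
  by rewrite (big_tuple0 (fun X => H (mask X [::]) (mask (map negb X) [::]))).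
rewrite (@big_tupleS _ _ _ (fun X => H (mask X (s :: ss)) (mask (map negb X) (s :: ss)))).
by rewrite big_bool -!IH.
Qed.

Lemma split_sum_nill ss (H : seq T -> seq T -> V) :
  split_sum ss (fun a b => if a is [::] then H a b else 0) = H [::] ss.
Proof.
elim: ss H => //= s ss IH H.
rewrite [X in X + _](_ : _ = 0) ?add0r; first exact: (IH (fun a b => H a (s :: b))).
by elim: ss {IH} => //= _ ss IH; rewrite IH addr0.
Qed.

Lemma split_sum_nilr ss (H : seq T -> seq T -> V) :
  split_sum ss (fun a b => if b is [::] then H a b else 0) = H ss [::].
Proof.
elim: ss H => //= s ss IH H.
rewrite [X in _ + X](_ : _ = 0) ?addr0; first exact: (IH (fun a b => H (s :: a) b)).
by elim: ss {IH} => //= _ ss IH; rewrite IH addr0.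
Qed.

End Generic.

(** Subsequences inherit being heap forests, and the permutation keeps track of labels and sizes. *)
Lemma eq_split_sum (T : eqType) (V : nmodType) (ss : seq T) (H H' : seq T -> seq T -> V) :
  (forall a b, subseq a ss -> subseq b ss -> perm_eq (a ++ b) ss -> H a b = H' a b) ->
  split_sum ss H = split_sum ss H'.
Proof.
elim: ss H H' => [|s ss IH] H H' HH /=; first exact: HH.
congr (_ + _); apply: IH => a b sa sb pab; apply: HH => //=.
- by rewrite eqxx.
- by apply: subseq_trans sb (subseq_cons _ _).
- by rewrite perm_cons.
- by apply: subseq_trans sa (subseq_cons _ _).
- by rewrite eqxx.
- by rewrite -cat_rcons -cats1 -catA perm_catCA perm_cons.
Qed.

Section Linear.

Variables (k : fieldType) (U V : lmodType k) (f : U -> V).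
Hypothesis fL : linear f.

Lemma linfun_assign_sum (T : Type) (ss : seq T) pts H :
  f (assign_sum ss pts H) = assign_sum ss pts (fun ps => f (H ps)).
Proof.
by elim: ss H => //= s ss IH H; rewrite linfun_sum //; apply: eq_bigr => o _; rewrite IH.
Qed.

Lemma linfun_split_sum (T : Type) (ss : seq T) H :
  f (split_sum ss H) = split_sum ss (fun a b => f (H a b)).
Proof. by elim: ss H => //= s ss IH H; rewrite linfunD // !IH. Qed.

End Linear.

Lemma exchange_split_sum (T T' : Type) (V : nmodType) (ss : seq T) (ss' : seq T')
    (H : seq T -> seq T -> seq T' -> seq T' -> V) :
  split_sum ss (fun a b => split_sum ss' (H a b)) =
  split_sum ss' (fun c d => split_sum ss (fun a b => H a b c d)).
Proof. by elim: ss' H => //= s ss' IH H; rewrite split_sumD !IH. Qed.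

End AssignmentSums.

(** * Relabelling, grafting and attachment *)

Section ForestLemmas.

Local Open Scope nat_scope.

Implicit Types (f : nat -> nat) (t : htree) (F : seq htree).
Implicit Types (N : nat -> seq htree) (ps : seq (htree * option nat)).

Lemma eq_in_graft N M t : {in labels t, N =1 M} -> graft N t = graft M t.
Proof.
elim/htree_mem_ind: t => i ts IH NM /=; rewrite NM ?mem_head //.
congr (HNode i (_ ++ _)); apply/eq_in_map => t tts; apply: IH => // a at_.
by apply: NM; rewrite inE (mem_flabels tts) ?orbT.
Qed.

Lemma graft_graft M N t :
  graft M (graft N t) = graft (fun a => map (graft M) (N a) ++ M a) t.
Proof.
elim/htree_mem_ind: t => i ts IH /=; rewrite map_cat -catA; congr (HNode i (_ ++ _)).
by rewrite -map_comp; apply/eq_in_map.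
Qed.

Lemma relabel_graft f N M t :
  {in labels t, forall a, M (f a) = map (relabel f) (N a)} ->
  relabel f (graft N t) = graft M (relabel f t).
Proof.
elim/htree_mem_ind: t => i ts IH NM /=; rewrite NM ?mem_head // map_cat.
congr (HNode _ (_ ++ _)); rewrite -!map_comp; apply/eq_in_map => t tts.
by apply: IH => // a at_; apply: NM; rewrite inE (mem_flabels tts) ?orbT.
Qed.

Lemma eq_in_relabel f g t : {in labels t, f =1 g} -> relabel f t = relabel g t.
Proof.
elim/htree_mem_ind: t => i ts IH fg /=; rewrite fg ?mem_head //; congr HNode.
apply/eq_in_map => t tts; apply: IH => // a at_.
by apply: fg; rewrite inE (mem_flabels tts) ?orbT.
Qed.

Lemma eq_in_map_relabel f g F :
  {in flabels F, f =1 g} -> map (relabel f) F = map (relabel g) F.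
Proof.
move=> fg; apply/eq_in_map => t tF; apply: eq_in_relabel => a at_.
exact/fg/(mem_flabels tF).
Qed.

Lemma relabel_comp f g t : relabel f (relabel g t) = relabel (f \o g) t.
Proof.
elim/htree_mem_ind: t => i ts IH /=; congr HNode.
by rewrite -map_comp; apply/eq_in_map.
Qed.

Lemma map_relabel_comp f g F :
  map (relabel f) (map (relabel g) F) = map (relabel (f \o g)) F.
Proof. by rewrite -map_comp; apply: eq_map => t; apply: relabel_comp. Qed.

Lemma relabel_id t : relabel id t = t.
Proof.
elim/htree_mem_ind: t => i ts IH /=; congr HNode.
by rewrite -[RHS]map_id; apply/eq_in_map.
Qed.

Lemma map_relabel_id F f : {in flabels F, f =1 id} -> map (relabel f) F = F.
Proof.
move/eq_in_map_relabel ->; rewrite -[RHS]map_id.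
by apply: eq_map => t; apply: relabel_id.
Qed.

Lemma rank_map f (L : seq nat) j : {in L &, {homo f : i j / i < j}} -> j \in L ->
  rank (map f L) (f j) = rank L j.
Proof.
move=> fL jL; rewrite /rank count_map; apply: eq_in_count => i iL /=.
apply/idP/idP => [|ij]; last exact: fL.
by case: (ltngtP i j) => // [/fL h|->]; [have := h jL iL; lia|rewrite ltnn].
Qed.

Lemma perm_rank (L L' : seq nat) : perm_eq L L' -> rank L =1 rank L'.
Proof. by move=> pL j; apply: (seq.permP pL). Qed.

Lemma rank_iota m n j : j <= n -> rank (iota m n) (m + j) = j.
Proof.
move=> jn; rewrite /rank -(subnKC jn) iotaD count_cat.
rewrite (_ : count _ _ = j); last first.
  rewrite -[RHS](size_iota m) -[RHS]count_predT; apply: eq_in_count => i.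
  by rewrite mem_iota /=; lia.
rewrite (_ : count _ _ = 0) ?addn0 //; apply/eqP; rewrite -leqn0 leqNgt -has_count.
by apply/hasPn => i; rewrite mem_iota /=; lia.
Qed.

(** Ranks depend only on the relative order of the labels. *)
Lemma st_map_relabel f F m : {in flabels F &, {homo f : i j / i < j}} ->
  st (map (relabel f) F) m = st F m.
Proof.
move=> fF; rewrite /st map_relabel_comp; apply: eq_in_map_relabel => j jF /=.
by rewrite flabels_relabel rank_map.
Qed.

Lemma st_st F m n : st (st F m) n = st F n.
Proof.
apply: st_map_relabel => i j iF jF ij; rewrite ltn_add2r; exact: rank_homo.
Qed.

Lemma st_std n F m : std_forest n F -> st F m = map (relabel (addn m)) F.
Proof.
case/andP=> _ pF; apply: eq_in_map_relabel => j jF.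
rewrite (perm_rank pF) -[X in rank _ X]add0n rank_iota 1?addnC //.
by move: jF; rewrite (perm_mem pF) mem_iota => /andP[_ /ltnW].
Qed.

Lemma st0_std n F : std_forest n F -> st F 0 = F.
Proof. by move/st_std->; apply: map_relabel_id. Qed.

Lemma flabels_cons t F : flabels (t :: F) = labels t ++ flabels F.
Proof. by []. Qed.

Lemma subseq_flabels F1 F2 : subseq F1 F2 -> subseq (flabels F1) (flabels F2).
Proof.
elim: F2 F1 => [|t F2 IH] [|t1 F1] //=; first by rewrite sub0seq.
case: eqP => [-> /IH s|_ /IH s]; first by rewrite !flabels_cons cat_subseq.
by rewrite flabels_cons; apply: subseq_trans s _; apply: suffix_subseq.
Qed.

Lemma heap_forest_subseq F1 F2 : subseq F1 F2 -> heap_forest F2 -> heap_forest F1.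
Proof. by case/subseqP => m _ ->; apply: heap_forest_mask. Qed.

Lemma flabels_perm F1 F2 : perm_eq F1 F2 -> perm_eq (flabels F1) (flabels F2).
Proof.
by move=> p; apply/seq.permP => P; rewrite !count_flabels; apply: perm_big.
Qed.

Definition attach_pairs ps F :=
  map (graft (fun a => place ps (Some a))) F ++ place ps None.

Lemma place_relabel f (L : seq nat) ps o : {in L &, injective f} ->
  {subset unzip2 ps <= None :: map Some L} -> o \in None :: map Some L ->
  place [seq (relabel f p.1, omap f p.2) | p <- ps] (omap f o) =
  map (relabel f) (place ps o).
Proof.
move=> fI sub oL; rewrite /place filter_map -!map_comp; congr map.
apply: eq_in_filter => p pps /=.
have {sub}: p.2 \in None :: map Some L by apply/sub/map_f.
case: p.2 oL => [b|] //; case: o => [a|] //=; rewrite !inE /=.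
rewrite !(mem_map (@Some_inj _)) => aL bL.
by apply/eqP/eqP => [[/fI->]|[->]].
Qed.

Lemma relabel_attach f (L : seq nat) ps F : {in L &, injective f} ->
  {subset flabels F <= L} -> {subset unzip2 ps <= None :: map Some L} ->
  map (relabel f) (attach_pairs ps F) =
  attach_pairs [seq (relabel f p.1, omap f p.2) | p <- ps] (map (relabel f) F).
Proof.
move=> fI FL sub; rewrite /attach_pairs map_cat; congr (_ ++ _).
  rewrite -!map_comp; apply/eq_in_map => t tF /=; apply: relabel_graft => a at_.
  apply: (place_relabel fI sub (o := Some a)).
  by rewrite inE /= (mem_map (@Some_inj _)) FL ?(mem_flabels tF).
by rewrite -(place_relabel fI sub (o := None)).
Qed.

(** As the labels of [F] are distinct, each member of [ps] is grafted exactly once. Counting the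
    labels that satisfy an arbitrary predicate gives the permutation. *)
Lemma flabels_attach ps F : uniq (flabels F) ->
  {subset unzip2 ps <= None :: map Some (flabels F)} ->
  perm_eq (flabels (attach_pairs ps F)) (flabels (unzip1 ps) ++ flabels F).
Proof.
move=> uF sub; apply/seq.permP => P; rewrite flabels_cat !count_cat.
pose c ps o := count P (flabels (place ps o)).
rewrite [X in X + _](_ : _ = count P (flabels F) + \sum_(a <- flabels F) c ps (Some a)).
  rewrite -addnA addnC; congr (_ + _).
  have uo : uniq (None :: map Some (flabels F)).
    rewrite /= map_inj_uniq ?uF ?andbT; last by move=> ? ? [].
    by apply/mapP => -[].
  transitivity (\sum_(o <- None :: map Some (flabels F)) c ps o).
    by rewrite big_cons big_map addnC.
  move: (None :: _) uo sub => pts up; elim: ps => [|[t o] ps IH] sub.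
    by rewrite big1.
  rewrite /= flabels_cons count_cat -IH; last first.
    by move=> p pin; apply: sub; rewrite inE pin orbT.
  (* Peel off one pair: its tree is counted at its own point only. *)
  transitivity (\sum_(o' <- pts) ((if o' == o then count P (labels t) else 0) + c ps o')).
    apply: eq_bigr => o' _; rewrite /c /place /= eq_sym.
    by case: eqP => //= _; rewrite flabels_cons count_cat.
  rewrite big_split /= -big_mkcond /=; congr (_ + _).
  rewrite -big_filter filter_pred1_uniq ?big_seq1 //.
  by apply: sub; rewrite mem_head.
rewrite !count_flabels big_map; under eq_bigr do rewrite count_labels_graft.
by rewrite big_split /= [\sum_(_ <- flabels F) _]big_flatten big_map.
Qed.

(** The threshold [n] puts every attached label above every label of [F]: the new trees may hang
    below any node, and appending them keeps siblings increasing. *)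
Lemma heap_forest_attach n ps F : heap_forest (unzip1 ps) -> heap_forest F ->
  all (gtn n) (flabels F) -> all (leq n) (flabels (unzip1 ps)) ->
  {subset unzip2 ps <= None :: map Some (flabels F)} ->
  heap_forest (attach_pairs ps F).
Proof.
case/and3P=> Ss Sh Su /and3P[Fs Fh Fu] Fn Sn sub.
have rS : all (leq n) (map root (unzip1 ps)).
  by apply/allP => _ /mapP[t tS ->]; apply/(allP Sn)/(mem_flabels tS)/root_labels.
have sp o : subseq (place ps o) (unzip1 ps).
  by apply: map_subseq; apply: filter_subseq.
have hN o : [&& sorted ltn (map root (place ps o)), all heap (place ps o) &
                all (leq n) (map root (place ps o))].
  apply/and3P; split.
  - exact: (subseq_sorted ltn_trans (map_subseq _ (sp o))).
  - by apply/allP => t /(mem_subseq (sp o)) /(allP Sh).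
  - by apply/allP => t /(mem_subseq (map_subseq root (sp o))) /(allP rS).
have rF : all (gtn n) (map root F).
  by apply/allP => _ /mapP[t tF ->]; apply/(allP Fn)/(mem_flabels tF)/root_labels.
apply/and3P; split.
- have /and3P[? _ ?] := hN None.
  by apply: (@sorted_roots_cat n); rewrite ?map_root_graft.
- rewrite all_cat; have /and3P[_ -> _] := hN None; rewrite andbT.
  apply/allP => _ /mapP[t tF ->].
  apply: (@heap_graft _ n) => //; last exact: (allP Fh).
  by apply/allP => x xt; apply/(allP Fn)/(mem_flabels tF).
- rewrite (perm_uniq (flabels_attach Fu sub)) cat_uniq Su Fu andbT /=.
  apply/hasPn => x /(allP Fn) xn; apply/negP => /(allP Sn) /=.
  by move: xn => /=; lia.
Qed.

End ForestLemmas.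

(** * Regrouping nested sums of assignments and splittings *)

Section NestedSums.

Local Open Scope ring_scope.

Variables (T : Type) (V : nmodType).

Lemma place_filter (P : pred (option nat)) (ps : seq (T * option nat)) o :
  place [seq p <- ps | P p.2] o = if P o then place ps o else [::].
Proof.
rewrite /place -filter_predI; case Po: (P o).
  by congr map; apply: eq_filter => p /=; case: eqP => // ->.
rewrite (eq_filter (a2 := pred0)) ?filter_pred0 // => p /=.
by case: eqP => // ->.
Qed.

Lemma place_map (T' : Type) (f : T -> T') (ps : seq (T * option nat)) o :
  place [seq (f p.1, p.2) | p <- ps] o = map f (place ps o).
Proof. by rewrite /place filter_map -!map_comp. Qed.

Lemma assign_sum0 (S : seq T) pts : assign_sum S pts (fun _ => 0 : V) = 0.
Proof. by elim: S => //= s S ->; rewrite big1. Qed.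

Lemma assign_sum1 (S : seq T) o (H : seq (T * option nat) -> V) :
  assign_sum S [:: o] H = H [seq (s, o) | s <- S].
Proof. by elim: S H => //= s S IH H; rewrite big_seq1 IH. Qed.

Lemma split_sum_big (U : Type) I (rI : seq I) (S : seq U)
    (H : I -> seq U -> seq U -> V) :
  split_sum S (fun a b => \sum_(i <- rI) H i a b) =
  \sum_(i <- rI) split_sum S (H i).
Proof. by elim: S H => //= s S IH H; rewrite !IH big_split. Qed.

Lemma split_sumC (U : Type) (S : seq U) (H : seq U -> seq U -> V) :
  split_sum S (fun a b => H b a) = split_sum S H.
Proof.
elim: S H => //= s S IH H; rewrite addrC; congr (_ + _).
  exact: (IH (fun a b => H (s :: a) b)).
exact: (IH (fun a b => H a (s :: b))).
Qed.

(* Two successive choices of attachment points, the second one for the members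
   sent to the extra point by the first one, amount to a single choice. *)
Lemma assign_sum_nested (S : seq T) (L2 L3 : seq nat)
    (K : seq (T * option nat) -> seq (T * option nat) -> V) :
  {in L3, forall a, a \notin L2} ->
  assign_sum S (None :: map Some L2) (fun ps =>
    assign_sum (place ps None) (None :: map Some L3)
      (K [seq p <- ps | p.2 != None])) =
  assign_sum S (None :: map Some (L3 ++ L2)) (fun rs =>
    K [seq p <- rs | p.2 \in map Some L2] [seq p <- rs | p.2 \notin map Some L2]).
Proof.
move=> L32; elim: S K => //= s S IH K.
rewrite big_cons map_cat -cat_cons big_cat /=; congr (_ + _).
  rewrite assign_sum_big; apply: eq_big_seq => o oL3.
  rewrite (IH (fun x y => K x ((s, o) :: y))) map_cat.
  have -> // : o \in map Some L2 = false.
  move: oL3; rewrite inE => /orP[/eqP->|/mapP[a /L32 aL2 ->]].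
    by apply/negP => /mapP[].
  by apply/negbTE; rewrite (mem_map (@Some_inj _)).
rewrite !big_map; apply: eq_big_seq => a aL2 /=.
by rewrite (IH (fun x y => K ((s, Some a) :: x) y)) map_cat (map_f Some aL2).
Qed.

(** The combinatorial core of the multiplicativity of the coproduct. A member attached inside one
    half goes with that half, and a member at the root may go with either; so each belongs to [SA],
    at a point of [LA] or the root, or to [SB], at a point of [LB] or the root. *)
Lemma assign_sum_split_place (S : seq T) (LA LB : seq nat)
    (K : seq (T * option nat) -> seq T -> seq (T * option nat) -> seq T -> V) :
  {in LA, forall a, a \notin LB} ->
  assign_sum S (None :: map Some (LA ++ LB)) (fun ps =>
    split_sum (place ps None) (fun C D =>
      K [seq p <- ps | p.2 \in map Some LA] C [seq p <- ps | p.2 \in map Some LB] D)) =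
  split_sum S (fun SA SB =>
    assign_sum SA (None :: map Some LA) (fun p =>
      assign_sum SB (None :: map Some LB) (fun q =>
        K [seq x <- p | x.2 != None] (place p None)
          [seq x <- q | x.2 != None] (place q None)))).
Proof.
move=> LAB; elim: S K => //= s S IH K.
rewrite [X in X = _]big_cons map_cat big_cat /=.
have nS L : None \in map (@Some nat) L = false by apply/mapP => -[].
rewrite !nS.
(* In [E1] and [E2] the member [s] sits at the root and goes to the left, respectively right,
   part. *)
have E1 : assign_sum S (None :: map Some LA ++ map Some LB) (fun ps =>
    split_sum (place ps None) (fun C D => K [seq p <- ps | p.2 \in map Some LA]
      (s :: C) [seq p <- ps | p.2 \in map Some LB] D)) = 
  split_sum S (fun SA SB =>
    assign_sum SA (None :: map Some LA) (fun p =>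
      assign_sum SB (None :: map Some LB) (fun q =>
        K [seq x <- p | x.2 != None] (s :: place p None)
          [seq x <- q | x.2 != None] (place q None)))).
  by rewrite -map_cat (IH (fun x C y D => K x (s :: C) y D)).
have E2 : assign_sum S (None :: map Some LA ++ map Some LB) (fun ps =>
    split_sum (place ps None) (fun C D => K [seq p <- ps | p.2 \in map Some LA]
      C [seq p <- ps | p.2 \in map Some LB] (s :: D))) = 
  split_sum S (fun SA SB =>
    assign_sum SA (None :: map Some LA) (fun p =>
      assign_sum SB (None :: map Some LB) (fun q =>
        K [seq x <- p | x.2 != None] (place p None)
          [seq x <- q | x.2 != None] (s :: place q None)))).
  by rewrite -map_cat (IH (fun x C y D => K x C y (s :: D))).
(* Regroup by the half that receives [s]: [E1] joins the points of [LA], and [E2] those of [LB]. *)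
rewrite assign_sumD E1 E2 addrACA; congr (_ + _).
  rewrite split_sum_big big_cons; congr (_ + _).
  rewrite !big_map; apply: eq_big_seq => a aLA.
  rewrite !(mem_map (@Some_inj _)) aLA (negbTE (LAB _ aLA)) -map_cat.
  exact: (IH (fun x C y D => K ((s, Some a) :: x) C y D)).
(* The choice of the point of [s] moves outside the choices made for [SA] and [SB]. *)
rewrite [RHS](_ : _ = \sum_(o <- None :: map Some LB) split_sum S (fun SA SB =>
    assign_sum SA (None :: map Some LA) (fun p =>
    assign_sum SB (None :: map Some LB) (fun q =>
        K [seq x <- p | x.2 != None] (place p None)
          [seq x <- (s, o) :: q | x.2 != None] (place ((s, o) :: q) None))))).
  rewrite big_cons; congr (_ + _).
  rewrite !big_map; apply: eq_big_seq => b bLB /=.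
  have /negbTE bLA : b \notin LA.
    by apply/negP => /LAB; rewrite bLB.
  rewrite !(mem_map (@Some_inj _)) bLB bLA -map_cat.
  exact: (IH (fun x C y D => K x C ((s, Some b) :: y) D)).
rewrite -split_sum_big; apply: split_sum_ext => SA SB.
by rewrite -assign_sum_big.
Qed.

End NestedSums.

(** * Iterated attachment of forests *)

Section ForestAttachment.

(** Here [q] attaches a middle forest, with labels in [L], to [F], and [rs] gives the points of a
    top forest. Grafting the members with a point in [L] into the trees of [q] beforehand agrees
    with attaching all of [rs] afterwards, since [L] and the labels of [F] are disjoint and both
    sides list the trees of [q] before those of [rs]. *)
Lemma attach_attach (rs q : seq (htree * option nat)) (F : seq htree) (L : seq nat) :
  {subset flabels (unzip1 q) <= L} -> {in flabels F, forall a, a \notin L} ->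
  attach_pairs
    ([seq (graft (fun a => place [seq p <- rs | p.2 \in map Some L] (Some a)) x.1, x.2)
     | x <- q] ++ [seq p <- rs | p.2 \notin map Some L]) F =
  attach_pairs rs (attach_pairs q F).
Proof.
move=> qL FL.
have gE o : map (graft (fun a => place [seq p <- rs | p.2 \in map Some L] (Some a)))
    (place q o) = map (graft (fun a => place rs (Some a))) (place q o).
  apply/eq_in_map => t /mapP[p]; rewrite mem_filter => /andP[_ pq] ->.
  apply: eq_in_graft => a ap.
  rewrite (place_filter (fun o => o \in map Some L)) (mem_map (@Some_inj _)).
  by rewrite qL // (mem_flabels _ ap) // map_f.
rewrite /attach_pairs map_cat -catA; congr (_ ++ _).
  rewrite -map_comp; apply/eq_in_map => t tF /=; rewrite graft_graft.
  apply: eq_in_graft => a at_; rewrite place_cat place_map gE.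
  rewrite (place_filter (fun o => o \notin map Some L)) (mem_map (@Some_inj _)).
  by rewrite FL ?(mem_flabels tF).
rewrite place_cat place_map gE (place_filter (fun o => o \notin map Some L)).
by rewrite (_ : None \in _ = false) //; apply/mapP => -[].
Qed.

Lemma map_graft_filter (P : pred (option nat)) (ps : seq (htree * option nat)) F :
  {in flabels F, forall a, P (Some a)} ->
  map (graft (fun a => place [seq p <- ps | P p.2] (Some a))) F =
  map (graft (fun a => place ps (Some a))) F.
Proof.
move=> PF; apply/eq_in_map => t tF; apply: eq_in_graft => a at_.
by rewrite place_filter PF ?(mem_flabels tF).
Qed.

Lemma graft_nil t : graft (fun _ => [::]) t = t.
Proof.
elim/htree_mem_ind: t => i ts IH /=; rewrite cats0; congr HNode.
by rewrite -[RHS]map_id; apply/eq_in_map.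
Qed.

Lemma attach_pairs_nil F : attach_pairs [::] F = F.
Proof.
rewrite /attach_pairs cats0 -[RHS]map_id; apply: eq_map => t.
exact: graft_nil.
Qed.

Lemma flabels_eq_nil F : (flabels F == [::]) = (F == [::]).
Proof. by case: F => [|[i ts] F]. Qed.

End ForestAttachment.

(** * The Hopf algebra of a forest model *)

Section ForestModels.

Local Open Scope ring_scope.

Variable k : fieldType.

(* The structure [D] read on forests: [e] sends a heap forest, with arbitrary
   labels, to the basis element of its standardisation, and [r] chooses the
   standard forest of a basis element. *)
Record forest_model (B : choiceType) (D : bialg_data k B)
    (e : seq htree -> B) (r : B -> seq htree) : Prop := ForestModel {
  model_mull : forall y, linear (fun x => bmul D x y);
  model_mulr : forall x, linear (bmul D x);
  model_comul : linear (bcomul D);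
  model_counit : scalar (bcounit D);
  model_heap : forall b, heap_forest (r b);
  model_reprK : cancel r e;
  model_repr : forall F, heap_forest F -> r (e F) = st F 0;
  model_mulE : forall m n F1 F2, std_forest m F1 -> std_forest n F2 ->
    bmul D << e F1 >> << e F2 >> =
    assign_sum (st F1 n) (None :: map Some (iota 0 n))
      (fun ps => << e (attach_pairs ps F2) >>);
  model_comulE : forall n F, std_forest n F ->
    bcomul D << e F >> = split_sum F (fun X Y => << (e X, e Y) >>);
  model_one : bone D = << e [::] >>;
  model_counitE : forall n F, std_forest n F ->
    bcounit D << e F >> = (F == [::])%:R
}.

Section Model.

Variables (B : choiceType) (D : bialg_data k B).
Variables (e : seq htree -> B) (r : B -> seq htree).
Hypothesis M : forest_model D e r.

Let mulL := model_mull M.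
Let mulR := model_mulr M.
Let comulL := model_comul M.
Let counitL : linear (bcounit D : {malg k[B]} -> k^o) := model_counit M.

(** [e] followed by [r] is standardisation, and [r] followed by [e] is the identity. *)
Lemma model_st F : heap_forest F -> e (st F 0) = e F.
Proof. by move=> /(model_repr M) <-; rewrite (model_reprK M). Qed.

Lemma model_relabel f F : {in flabels F &, {homo f : i j / (i < j)%N}} ->
  heap_forest F -> e (map (relabel f) F) = e F.
Proof.
move=> fF hF; rewrite -(model_st (heap_forest_relabel fF hF)).
by rewrite st_map_relabel // model_st.
Qed.

Lemma comul_model F : heap_forest F ->
  bcomul D << e F >> = split_sum F (fun X Y => << (e X, e Y) >>).
Proof.
move=> hF; rewrite -(model_st hF) (model_comulE M (std_forest_st hF)).
rewrite split_sum_map; apply: eq_split_sum => X Y sX sY _.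
have mono Z : subseq Z F ->
    {in flabels Z &, {homo (fun j => (rank (flabels F) j + 0)%N) : i j / (i < j)%N}}.
  move=> /subseq_flabels/mem_subseq sZ i j iZ jZ ij.
  by rewrite ltn_add2r; apply: rank_homo => //; apply: sZ.
by rewrite !model_relabel ?(heap_forest_subseq _ hF) //; apply: mono.
Qed.

Lemma counit_model F : heap_forest F -> bcounit D << e F >> = (F == [::])%:R.
Proof.
move=> hF; rewrite -(model_st hF) (model_counitE M (std_forest_st hF)).
by rewrite -!size_eq0 size_map.
Qed.

(** Since the labels of [F1] lie above those of [F2], a single increasing map, the rank in the union
    of the labels, standardises [F2] and sends [F1] to its standardisation shifted by the number of
    labels of [F2]. It turns this formula into the one for standard forests. *)
Lemma mul_model n F1 F2 : heap_forest F1 -> heap_forest F2 ->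
  all (leq n) (flabels F1) -> all (gtn n) (flabels F2) ->
  bmul D << e F1 >> << e F2 >> =
  assign_sum F1 (None :: map Some (flabels F2))
    (fun ps => << e (attach_pairs ps F2) >>).
Proof.
move=> h1 h2 F1n F2n; have F21 i j : i \in flabels F2 -> j \in flabels F1 -> (i < j)%N.
  by move=> /(allP F2n) + /(allP F1n) /=; apply: leq_trans.
set L := flabels F2 ++ flabels F1; set N := size (flabels F2).
have E2 : map (relabel (rank L)) F2 = st F2 0.
  apply: eq_in_map_relabel => j jF; rewrite /rank count_cat; congr (_ + _)%N.
  apply/eqP; rewrite -leqn0 leqNgt -has_count; apply/hasPn => i iF1 /=.
  by rewrite -leqNgt ltnW ?F21.
have E1 : map (relabel (rank L)) F1 = st F1 N.
  apply: eq_in_map_relabel => j jF; rewrite /rank count_cat addnC; congr (_ + _)%N.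
  by apply/eqP; rewrite -all_count; apply/allP => i iF2 /=; apply: F21.
have mono := @rank_homo L; have inj := homo_in_inj mono.
have u2 : uniq (flabels F2) by case/and3P: h2.
rewrite -(model_st h1) -(model_st h2).
rewrite (model_mulE M (std_forest_st h1) (std_forest_st h2)) st_st -/N -E1.
(* The same map carries the attachment points to those of the standard formula, up to order. *)
have pp : perm_eq (None :: map Some (iota 0 N))
    (map (omap (rank L)) (None :: map Some (flabels F2))).
  rewrite /= perm_cons -map_comp (_ : map _ (flabels F2) =
    map Some (map (rank L) (flabels F2))); last by rewrite -map_comp.
  apply: perm_map; rewrite perm_sym -flabels_relabel E2.
  by have /andP[] := std_forest_st h2.
rewrite (perm_assign_sum _ _ pp) assign_sum_map_pts assign_sum_map.
apply: eq_assign_sum => ps ps1 ps2; congr << _ >>.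
rewrite -map_comp -E2.
have subL : {subset unzip2 ps <= None :: map Some L}.
  move=> o /ps2; rewrite !inE => /orP[->//|/mapP[a aF ->]].
  by rewrite map_f ?orbT // mem_cat aF.
have F2L : {subset flabels F2 <= L} by move=> a aF; rewrite mem_cat aF.
rewrite -(relabel_attach inj F2L subL) model_relabel //; last first.
  by apply: (@heap_forest_attach n); rewrite ?ps1.
move=> i j; rewrite !(perm_mem (flabels_attach u2 ps2)) ps1 => iL jL.
by apply: mono; rewrite mem_cat orbC -mem_cat.
Qed.

(** Supplies representatives that meet the separation hypothesis of [mul_model]. *)
Lemma model_above b n : exists F, [/\ heap_forest F, e F = b &
  all (leq n) (flabels F)].
Proof.
have mono : {in flabels (r b) &, {homo addn n : i j / (i < j)%N}}.
  by move=> i j _ _; rewrite ltn_add2l.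
exists (map (relabel (addn n)) (r b)); split.
- exact: heap_forest_relabel (model_heap M b).
- by rewrite model_relabel ?(model_reprK M) //; apply: model_heap M b.
- by rewrite flabels_relabel; apply/allP => _ /mapP[j _ ->]; apply: leq_addr.
Qed.

Lemma flabels_bounded F n : exists2 m, (n <= m)%N & all (gtn m) (flabels F).
Proof.
exists (n + (\max_(j <- flabels F) j).+1)%N; first exact: leq_addr.
apply/allP => j jF /=; rewrite ltn_addl // ltnS.
by rewrite (leq_bigmax_seq (F := id)).
Qed.

(** * Unit and associativity *)

Lemma mul1_model x : bmul D (bone D) x = x.
Proof.
move: x; apply: linear_eq_basis => [||b]; [exact: mulR | exact: linear_id |].
rewrite (model_one M) -{1}(model_reprK M b).
have [n _ hn] := flabels_bounded (r b) 0.
rewrite (@mul_model n) ?(model_heap M) //=.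
by rewrite attach_pairs_nil (model_reprK M).
Qed.

Lemma mulm1_model x : bmul D x (bone D) = x.
Proof.
move: x; apply: linear_eq_basis => [||b]; [exact: mulL | exact: linear_id |].
rewrite (model_one M) -{1}(model_reprK M b).
rewrite (@mul_model 0%N) ?(model_heap M) //=; last by apply/allP.
rewrite assign_sum1 /attach_pairs /place /= filter_map /= -map_comp.
by rewrite (eq_filter (a2 := predT)) // filter_predT map_id (model_reprK M).
Qed.

(** The thresholds stack the labels, [F3] lowest and [F1] highest, so that every product falls under
    [mul_model]. Both sides become sums over attachments of [F2] to [F3] and of [F1] to the labels
    of both. *)
Lemma mulA_forest n m F1 F2 F3 : (n <= m)%N ->
  [/\ heap_forest F1, heap_forest F2 & heap_forest F3] ->
  all (gtn n) (flabels F3) -> all (leq n) (flabels F2) ->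
  all (gtn m) (flabels F2) -> all (leq m) (flabels F1) ->
  bmul D (bmul D << e F1 >> << e F2 >>) << e F3 >> =
  bmul D << e F1 >> (bmul D << e F2 >> << e F3 >>).
Proof.
move=> nm [h1 h2 h3] F3n F2n F2m F1m.
have F1n : all (leq n) (flabels F1).
  by apply/allP => i /(allP F1m) /=; apply: leq_trans.
have F3m : all (gtn m) (flabels F3).
  by apply/allP => i /(allP F3n) /= h; apply: leq_trans h nm.
have u2 : uniq (flabels F2) by case/and3P: h2.
have u3 : uniq (flabels F3) by case/and3P: h3.
have F32 a : a \in flabels F3 -> a \notin flabels F2.
  by move=> /(allP F3n) /= an; apply/negP => /(allP F2n) /=; rewrite leqNgt an.
rewrite (mul_model h1 h2 F1m F2m) (mul_model h2 h3 F2n F3n).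
rewrite (linfun_assign_sum (mulL _)) (linfun_assign_sum (mulR _)).
(* [q2] places the trees of [F2], [x] grafts members of [F1] into them, and [q1] places the members
   of [F1] left at the root. *)
pose K q2 x q1 : {malg k[B]} := << e (attach_pairs
  ([seq (graft (fun a => place x (Some a)) p.1, p.2) | p <- q2] ++ q1) F3) >>.
transitivity (assign_sum F1 (None :: map Some (flabels F2)) (fun ps =>
  assign_sum F2 (None :: map Some (flabels F3)) (fun q2 =>
    assign_sum (place ps None) (None :: map Some (flabels F3))
      (K q2 [seq p <- ps | p.2 != None])))).
  apply: eq_assign_sum => ps ps1 ps2.
  rewrite (@mul_model n) //.
  - rewrite [X in assign_sum X]/attach_pairs assign_sum_cat assign_sum_map.
    apply: eq_assign_sum => q2 _ _; apply: eq_assign_sum => q1 _ _.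
    rewrite /K [in LHS](@eq_map _ _ _ (fun p => (graft (fun a =>
      place [seq p <- ps | p.2 != None] (Some a)) p.1, p.2))) // => p.
    congr pair; apply: eq_in_graft => a _.
    by rewrite (place_filter (fun o => o != None)).
  - by apply: (@heap_forest_attach m); rewrite ?ps1.
  - by rewrite (perm_all _ (flabels_attach u2 ps2)) ps1 all_cat F1n.
(* Now [F2] is placed on [F3] before [F1] is considered, as on the right-hand side. *)
rewrite exchange_assign_sum; apply: eq_assign_sum => q2 q21 q22.
rewrite assign_sum_nested //.
have pA := flabels_attach u3 q22; rewrite q21 in pA.
rewrite (@mul_model m) //; first last.
- by rewrite (perm_all _ pA) all_cat F2m.
- by apply: (@heap_forest_attach n); rewrite ?q21.
have pp : perm_eq (None :: map Some (flabels F3 ++ flabels F2))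
                  (None :: map Some (flabels (attach_pairs q2 F3))).
  by rewrite perm_cons perm_map // perm_sym (perm_trans pA) // perm_catC.
rewrite (perm_assign_sum _ _ pp); apply: eq_assign_sum => rs rs1 rs2.
rewrite /K attach_attach // q21.
by move=> a.
Qed.

Lemma mulA_model : associative (bmul D).
Proof.
move=> x y z; apply/esym; move: x; apply: linear_eq_basis => [||b1].
- exact: linear_comp (mulL _) (mulL _).
- exact: mulL.
move: y; apply: linear_eq_basis => [||b2].
- exact: linear_comp (mulL _) (mulR _).
- exact: linear_comp (mulR _) (mulL _).
move: z; apply: linear_eq_basis => [||b3].
- exact: mulR.
- exact: linear_comp (mulR _) (mulR _).
have [n _ F3n] := flabels_bounded (r b3) 0.
have [F2 [h2 <- F2n]] := model_above b2 n.
have [m nm F2m] := flabels_bounded F2 n.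
have [F1 [h1 <- F1m]] := model_above b1 m.
rewrite -(model_reprK M b3); apply: (@mulA_forest n m) => //.
by split=> //; apply: model_heap M b3.
Qed.

(** * Coalgebra axioms *)

Lemma comulA_model x :
  tassoc (tmap (bcomul D) id (bcomul D x)) = tmap id (bcomul D) (bcomul D x).
Proof.
move: x; apply: linear_eq_basis => [||b].
- exact: (linear_comp (@tassoc_linear _ _ _ _) (linear_comp (@tmap_linear _ _ _ _ _ _ _) comulL)).
- exact: (linear_comp (@tmap_linear _ _ _ _ _ _ _) comulL).
rewrite -(model_reprK M b); have hF := model_heap M b; set F := r b in hF *.
rewrite (comul_model hF) !(linfun_split_sum (tmap_linear _ _)).
rewrite (linfun_split_sum (@tassoc_linear _ _ _ _)).
transitivity (split_sum F (fun X Y => split_sum X (fun Z W =>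
    << (e Z, (e W, e Y)) >> : {malg k[_]}))).
  apply: eq_split_sum => X Y sX _ _; rewrite tmap_basis.
  rewrite comul_model ?(heap_forest_subseq sX) //.
  rewrite (linfun_split_sum (tensor_linearl _)).
  rewrite (linfun_split_sum (@tassoc_linear _ _ _ _)).
  by apply: split_sum_ext => Z W; rewrite tensor_basis tassoc_basis.
rewrite (split_sumA _ (fun X Z W => << (e X, (e Z, e W)) >>)).
apply: eq_split_sum => X Y _ sY _; rewrite tmap_basis.
rewrite comul_model ?(heap_forest_subseq sY) //.
rewrite (linfun_split_sum (tensor_linearr _)).
by apply: split_sum_ext => Z W; rewrite tensor_basis.
Qed.

Lemma comul_counitl_model x :
  linext (fun p => bcounit D << p.1 >> *: << p.2 >>) (bcomul D x) = x.
Proof.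
move: x; apply: linear_eq_basis => [||b].
- exact: (linear_comp (linext_linear _) comulL).
- exact: linear_id.
rewrite -(model_reprK M b); have hF := model_heap M b; set F := r b in hF *.
rewrite (comul_model hF) (linfun_split_sum (linext_linear _)).
rewrite -[RHS](split_sum_nill F (fun _ Y => << e Y >>)).
apply: eq_split_sum => X Y sX _ _; rewrite linext_basis /=.
rewrite counit_model ?(heap_forest_subseq sX) //.
by case: X {sX} => [|t X]; rewrite ?scale1r ?scale0r.
Qed.

Lemma comul_counitr_model x :
  linext (fun p => bcounit D << p.2 >> *: << p.1 >>) (bcomul D x) = x.
Proof.
move: x; apply: linear_eq_basis => [||b].
- exact: (linear_comp (linext_linear _) comulL).
- exact: linear_id.
rewrite -(model_reprK M b); have hF := model_heap M b; set F := r b in hF *.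
rewrite (comul_model hF) (linfun_split_sum (linext_linear _)).
rewrite -[RHS](split_sum_nilr F (fun X _ => << e X >>)).
apply: eq_split_sum => X Y _ sY _; rewrite linext_basis /=.
rewrite counit_model ?(heap_forest_subseq sY) //.
by case: Y {sY} => [|t Y]; rewrite ?scale1r ?scale0r.
Qed.

(** * Compatibility of product and coproduct *)

(** Trees of [F1] grafted into [F2] move with the component that carries them, whereas those left at
    the root are split freely. *)
Lemma comulM_forest n F1 F2 : heap_forest F1 -> heap_forest F2 ->
  all (leq n) (flabels F1) -> all (gtn n) (flabels F2) ->
  bcomul D (bmul D << e F1 >> << e F2 >>) =
  tmul (bmul D) (bcomul D << e F1 >>) (bcomul D << e F2 >>).
Proof.
move=> h1 h2 F1n F2n; have u2 : uniq (flabels F2) by case/and3P: h2.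
rewrite (mul_model h1 h2 F1n F2n) (linfun_assign_sum comulL).
rewrite (comul_model h1) (comul_model h2).
rewrite (linfun_split_sum (tmul_linearl _ _)).
pose K A Y x C y E : {malg k[(B * B)%type]} :=
  << (e (map (graft (fun a => place x (Some a))) A ++ C),
      e (map (graft (fun a => place y (Some a))) Y ++ E)) >>.
transitivity (split_sum F2 (fun A Y =>
  assign_sum F1 (None :: map Some (flabels F2)) (fun ps =>
    split_sum (place ps None) (fun C E => K A Y ps C ps E)))).
  rewrite -exchange_assign_split_sum; apply: eq_assign_sum => ps ps1 ps2.
  rewrite comul_model; last by apply: (@heap_forest_attach n); rewrite ?ps1.
  by rewrite split_sum_cat split_sum_map.
transitivity (split_sum F2 (fun A Y => split_sum F1 (fun X Z =>
  tmul (bmul D) << (e X, e Z) >> << (e A, e Y) >>))); last first.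
  rewrite exchange_split_sum; apply: split_sum_ext => X Z.
  by rewrite (linfun_split_sum (tmul_linearr _ _)).
apply: eq_split_sum => A Y sA sY pF.
have pf : perm_eq (flabels F2) (flabels A ++ flabels Y).
  by rewrite -flabels_cat flabels_perm // perm_sym.
have dis : {in flabels A, forall a, a \notin flabels Y}.
  move: u2; rewrite (perm_uniq pf) cat_uniq => /and3P[_ /hasPn h _] a aA.
  by apply/negP => /h; rewrite /= aA.
have pp : perm_eq (None :: map Some (flabels F2))
                  (None :: map Some (flabels A ++ flabels Y)).
  by rewrite perm_cons perm_map.
rewrite (perm_assign_sum _ _ pp).
(* Only points inside [A] matter for [A], and likewise for [Y]; restricting the assignment to each
   separates the two tensor factors. *)
transitivity (assign_sum F1 (None :: map Some (flabels A ++ flabels Y)) (fun ps =>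
    split_sum (place ps None) (fun C E =>
      K A Y [seq p <- ps | p.2 \in map Some (flabels A)] C
            [seq p <- ps | p.2 \in map Some (flabels Y)] E))).
  apply: eq_assign_sum => ps _ _; apply: split_sum_ext => C E.
  by rewrite /K !(map_graft_filter (P := fun o => o \in map Some _)) // => a aF;
    rewrite map_f.
rewrite assign_sum_split_place //.
have hA := heap_forest_subseq sA h2; have hY := heap_forest_subseq sY h2.
have An : all (gtn n) (flabels A).
  by apply/allP => a /(mem_subseq (subseq_flabels sA)) /(allP F2n).
have Yn : all (gtn n) (flabels Y).
  by apply/allP => a /(mem_subseq (subseq_flabels sY)) /(allP F2n).
apply: eq_split_sum => X Z sX sZ _; rewrite tmul_basis.
have hX := heap_forest_subseq sX h1; have hZ := heap_forest_subseq sZ h1.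
have Xn : all (leq n) (flabels X).
  by apply/allP => a /(mem_subseq (subseq_flabels sX)) /(allP F1n).
have Zn : all (leq n) (flabels Z).
  by apply/allP => a /(mem_subseq (subseq_flabels sZ)) /(allP F1n).
rewrite (mul_model hX hA Xn An) (mul_model hZ hY Zn Yn).
rewrite (linfun_assign_sum (tensor_linearl _)); apply: eq_assign_sum => p _ _.
rewrite (linfun_assign_sum (tensor_linearr _)); apply: eq_assign_sum => q _ _.
by rewrite tensor_basis /K !(map_graft_filter (P := fun o => o != None)).
Qed.

(** Any two basis elements have representatives with separated labels, by shifting those of the
    first. *)
Lemma bilinear_eq_forest (V : lmodType k) (f g : {malg k[B]} -> {malg k[B]} -> V) :
  (forall y, linear (f^~ y)) -> (forall x, linear (f x)) ->
  (forall y, linear (g^~ y)) -> (forall x, linear (g x)) ->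
  (forall n F1 F2, heap_forest F1 -> heap_forest F2 ->
     all (leq n) (flabels F1) -> all (gtn n) (flabels F2) ->
     f << e F1 >> << e F2 >> = g << e F1 >> << e F2 >>) ->
  forall x y, f x y = g x y.
Proof.
move=> fl fr gl gr fg x y; move: x.
apply: linear_eq_basis => // b1; move: y; apply: linear_eq_basis => // b2.
have [n _ F2n] := flabels_bounded (r b2) 0.
have [F1 [h1 <- F1n]] := model_above b1 n.
rewrite -(model_reprK M b2); apply: (fg n) => //; exact: model_heap M b2.
Qed.

Lemma comulM_model x y :
  bcomul D (bmul D x y) = tmul (bmul D) (bcomul D x) (bcomul D y).
Proof.
move: x y; apply: bilinear_eq_forest => [y|x|y|x|].
- exact: linear_comp comulL (mulL _).
- exact: linear_comp comulL (mulR _).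
- exact: linear_comp (tmul_linearl _ _) comulL.
- exact: linear_comp (tmul_linearr _ _) comulL.
- exact: comulM_forest.
Qed.

Lemma counitM_model x y : bcounit D (bmul D x y) = bcounit D x * bcounit D y.
Proof.
move: x y.
apply: (@bilinear_eq_forest k^o (fun x y => bcounit D (bmul D x y))
  (fun x y => bcounit D x * bcounit D y)) => [y|x|y|x|n F1 F2 h1 h2 F1n F2n].
- exact: linear_comp counitL (mulL _).
- exact: linear_comp counitL (mulR _).
- by move=> a u v; rewrite counitL mulrDl; congr (_ + _); apply/esym/mulrA.
- by move=> a u v; rewrite counitL mulrDr; congr (_ + _); apply: mulrCA.
have u2 : uniq (flabels F2) by case/and3P: h2.
rewrite !counit_model // (mul_model h1 h2 F1n F2n) (linfun_assign_sum counitL).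
case: F1 h1 F1n => [|t F1] h1 F1n.
  by rewrite /= attach_pairs_nil counit_model // mul1r.
(* A nonempty [F1] gives a nonempty forest wherever it is attached, so every summand has counit
   zero. *)
rewrite mul0r -[RHS](assign_sum0 k^o (t :: F1) (None :: map Some (flabels F2))).
apply: eq_assign_sum => ps ps1 ps2; rewrite counit_model; last first.
  by apply: (@heap_forest_attach n); rewrite ?ps1.
rewrite -flabels_eq_nil -size_eq0 (perm_size (flabels_attach u2 ps2)) ps1.
by rewrite size_cat addn_eq0 size_eq0 flabels_eq_nil.
Qed.

Lemma model_bialgebra : is_bialgebra D.
Proof.
split.
- split; [exact: mulL|exact: mulR|exact: mulA_model|exact: mul1_model|].
  exact: mulm1_model.
- split; [exact: comulL|exact: model_counit M|exact: comulA_model| |].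
    exact: comul_counitl_model.
  exact: comul_counitr_model.
- exact: comulM_model.
- by rewrite (model_one M) comul_model //= tensor_basis.
- exact: counitM_model.
- by rewrite (model_one M) counit_model.
Qed.

(* The recursive formula for a convolution inverse of the identity; [n] is an
   upper bound for the number of trees of [F]. *)
Fixpoint conv_inverse (m : {malg k[B]} -> {malg k[B]} -> {malg k[B]})
    (n : nat) (F : seq htree) : {malg k[B]} :=
  if n is n'.+1 then
    if F is [::] then bone D else
    - split_sum F (fun X Y =>
        if Y is [::] then 0 else m (conv_inverse m n' X) << e Y >>)
  else bone D.

(** * The antipode by recursion *)

Section ConvolutionInverse.

Variable m : {malg k[B]} -> {malg k[B]} -> {malg k[B]}.
Hypothesis mm1 : forall x, m x (bone D) = x.

Lemma conv_inverse_cons n t F : conv_inverse m n.+1 (t :: F) =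
  - split_sum (t :: F) (fun X Y =>
      if Y is [::] then 0 else m (conv_inverse m n X) << e Y >>).
Proof. by []. Qed.

(** Only parts [X] with nonempty complement enter the recursion, hence forests with fewer trees, so
    any sufficient bound gives the same value. *)
Lemma conv_inverse_bound n n' F : (size F <= n)%N -> (size F <= n')%N ->
  conv_inverse m n F = conv_inverse m n' F.
Proof.
elim: n n' F => [|n IH] [|n'] [|t F] // Fn Fn'; rewrite !conv_inverse_cons.
congr (- _); apply: eq_split_sum => X [|s Y] // sX sY pXY.
congr (m _ _); apply: IH.
  have := perm_size pXY; rewrite size_cat /=; move: Fn => /=; lia.
have := perm_size pXY; rewrite size_cat /=; move: Fn' => /=; lia.
Qed.

Lemma conv_inverse_relabel n f F :
  {in flabels F &, {homo f : i j / (i < j)%N}} -> heap_forest F ->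
  conv_inverse m n (map (relabel f) F) = conv_inverse m n F.
Proof.
elim: n F => [|n IH] [|t F] // fF hF.
rewrite [map _ _]/= !conv_inverse_cons.
rewrite -[relabel f t :: _]/(map (relabel f) (t :: F)).
congr (- _); rewrite split_sum_map; apply: eq_split_sum => X [|s Y] // sX sY _.
have sub Z : subseq Z (t :: F) -> {in flabels Z &, {homo f : i j / (i < j)%N}}.
  move=> /subseq_flabels/mem_subseq sZ i j iZ jZ ij.
  by apply: fF => //; apply: sZ.
rewrite IH ?(heap_forest_subseq sX) //; last exact: sub.
by rewrite -[e (s :: Y)](model_relabel (sub _ sY)) ?(heap_forest_subseq sY).
Qed.

(** For nonempty [F], the summand with [Y] empty is the inverse at [F] itself, by definition minus
    the sum of the others. *)
Lemma conv_inverseE F :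
  split_sum F (fun X Y => m (conv_inverse m (size X) X) << e Y >>) =
  (F == [::])%:R *: bone D.
Proof.
case: F => [|t F]; first by rewrite /= -(model_one M) mm1 scale1r.
rewrite scale0r; set G := t :: F.
rewrite (@split_sum_ext _ _ G _ (fun X Y =>
  (if Y is [::] then m (conv_inverse m (size X) X) << e Y >> else 0) +
  (if Y is [::] then 0 else m (conv_inverse m (size X) X) << e Y >>))); last first.
  by move=> X [|s Y]; rewrite ?addr0 ?add0r.
rewrite split_sumD split_sum_nilr -(model_one M) mm1.
rewrite [conv_inverse m (size G) G]conv_inverse_cons.
rewrite addrC; apply/eqP; rewrite subr_eq0; apply/eqP.
apply: eq_split_sum => X [|s Y] // sX sY pXY.
congr (m _ _); apply: conv_inverse_bound => //.
by rewrite -ltnS -[(size F).+1]/(size G) -(perm_size pXY) size_cat /= addnS ltnS leq_addr.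
Qed.

End ConvolutionInverse.

Let SL F := conv_inverse (bmul D) (size F) F.
Let SR F := conv_inverse (fun x y => bmul D y x) (size F) F.

Lemma conv_inversel F :
  split_sum F (fun X Y => bmul D (SL X) << e Y >>) = (F == [::])%:R *: bone D.
Proof. exact: conv_inverseE mulm1_model F. Qed.

(* The coproduct is cocommutative, hence a right inverse for the product is a
   left inverse for the opposite one. *)
Lemma conv_inverser F :
  split_sum F (fun X Y => bmul D << e X >> (SR Y)) = (F == [::])%:R *: bone D.
Proof.
rewrite -(conv_inverseE (m := fun x y => bmul D y x)); last exact: mul1_model.
by rewrite -split_sumC.
Qed.

(** In the convolution algebra, [SL] is expanded as the product of [SL], the identity and [SR];
    [split_sumA] and [mulA_model] allow the other bracketing, which collapses to [SR]. *)
Lemma conv_inverse_lr F : SL F = SR F.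
Proof.
have nilE G (x : {malg k[B]}) :
    (if G is [::] then x else 0) = ((G : seq htree) == [::])%:R *: x.
  by case: G => [|t G]; rewrite ?scale1r ?scale0r.
transitivity (split_sum F (fun X Y => bmul D (SL X)
    (split_sum Y (fun Z W => bmul D << e Z >> (SR W))))).
  rewrite -[LHS](split_sum_nilr F (fun X _ => SL X)).
  apply: split_sum_ext => X Y; rewrite conv_inverser nilE.
  by rewrite (linfunZ (mulR _)) mulm1_model.
transitivity (split_sum F (fun X Y => bmul D
    (split_sum X (fun Z W => bmul D (SL Z) << e W >>)) (SR Y))).
  transitivity (split_sum F (fun X Y => split_sum Y (fun Z W =>
    bmul D (bmul D (SL X) << e Z >>) (SR W)))).
    apply: split_sum_ext => X Y; rewrite (linfun_split_sum (mulR _)).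
    by apply: split_sum_ext => Z W; rewrite mulA_model.
  rewrite -(split_sumA F (fun X Z W => bmul D (bmul D (SL X) << e Z >>) (SR W))).
  by apply: split_sum_ext => X Y; rewrite (linfun_split_sum (mulL _)).
rewrite -[RHS](split_sum_nill F (fun _ Y => SR Y)).
apply: split_sum_ext => X Y; rewrite conv_inversel nilE.
by rewrite (linfunZ (mulL _)) mul1_model.
Qed.

Lemma model_hopf : is_hopf D.
Proof.
split; first exact: model_bialgebra.
pose S := linext (fun b => SL (r b)); exists S.
(* [S] is defined through standard representatives, but splittings produce nonstandard forests, on
   which the recursion must still give its value. *)
have SL_st F : heap_forest F -> S << e F >> = SL F.
  move=> hF; rewrite /S linext_basis (model_repr M hF) /SL size_map.
  apply: conv_inverse_relabel => // i j iF jF ij.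
  by rewrite ltn_add2r; apply: rank_homo.
have Slin : linear S by apply: linext_linear.
split=> // x; move: x; apply: linear_eq_basis => [||b].
- apply: linear_comp; first exact: tlift_linear.
  by apply: linear_comp; first exact: tmap_linear.
- exact: linear_scale_const counitL.
- rewrite -(model_reprK M b); have hF := model_heap M b; set F := r b in hF *.
  rewrite (counit_model hF) (comul_model hF) -conv_inversel.
  rewrite (linfun_split_sum (tmap_linear _ _)) (linfun_split_sum (tlift_linear _)).
  apply: eq_split_sum => X Y sX sY _.
  by rewrite tmap_basis tlift_tensor // SL_st // (heap_forest_subseq sX).
- apply: linear_comp; first exact: tlift_linear.
  by apply: linear_comp; first exact: tmap_linear.
- exact: linear_scale_const counitL.
- rewrite -(model_reprK M b); have hF := model_heap M b; set F := r b in hF *.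
  rewrite (counit_model hF) (comul_model hF) -conv_inverser.
  rewrite (linfun_split_sum (tmap_linear _ _)) (linfun_split_sum (tlift_linear _)).
  apply: eq_split_sum => X Y sX sY _; rewrite tmap_basis tlift_tensor //.
  by rewrite SL_st ?(heap_forest_subseq sY) // conv_inverse_lr.
Qed.

End Model.

(** * Transport between two forest models *)

Section Isomorphism.

Variables (B C : choiceType) (D : bialg_data k B) (E : bialg_data k C).
Variables (e : seq htree -> B) (r : B -> seq htree).
Variables (e' : seq htree -> C) (r' : C -> seq htree).
Hypotheses (M : forest_model D e r) (M' : forest_model E e' r').
Variable f : {malg k[B]} -> {malg k[C]}.
Hypothesis fL : linear f.
Hypothesis fE : forall F, heap_forest F -> f << e F >> = << e' F >>.

Lemma model_morphism : is_bialg_morphism D E f.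
Proof.
have heap_r b : heap_forest (r b) := model_heap M b.
split=> //.
- apply: (bilinear_eq_forest M) => [y|x|y|x|n F1 F2 h1 h2 F1n F2n].
  + exact: linear_comp fL (model_mull M _).
  + exact: linear_comp fL (model_mulr M _).
  + exact: linear_comp (model_mull M' _) fL.
  + exact: linear_comp (model_mulr M' _) fL.
  rewrite !fE // (mul_model M h1 h2 F1n F2n) (mul_model M' h1 h2 F1n F2n).
  rewrite (linfun_assign_sum fL); apply: eq_assign_sum => ps ps1 ps2.
  by rewrite fE //; apply: (@heap_forest_attach n); rewrite ?ps1.
- by rewrite (model_one M) (model_one M') fE.
- apply: linear_eq_basis => [||b].
  + exact: linear_comp (model_comul M') fL.
  + exact: linear_comp (tmap_linear _ _) (model_comul M).
  rewrite -(model_reprK M b) fE // (comul_model M) // (comul_model M') //.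
  rewrite (linfun_split_sum (tmap_linear _ _)).
  apply: eq_split_sum => X Y sX sY _; rewrite tmap_basis !fE ?tensor_basis //.
    exact: heap_forest_subseq sY (heap_r b).
  exact: heap_forest_subseq sX (heap_r b).
- have cE : linear (bcounit E : {malg k[C]} -> k^o) := model_counit M'.
  apply: (@linear_eq_basis k B k^o (fun x => bcounit E (f x)) (bcounit D)) => [||b].
  + exact: linear_comp cE fL.
  + exact: model_counit M.
  by rewrite -(model_reprK M b) fE // (counit_model M) // (counit_model M').
Qed.

Lemma model_isomorphism : is_bialg_isomorphism D E f.
Proof.
split; first exact: model_morphism.
have heap_r b : heap_forest (r b) := model_heap M b.
have heap_r' b : heap_forest (r' b) := model_heap M' b.
(* The inverse reads off the standard forest of a basis element and rebuilds it on the other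
   side. *)
exists (linext (fun c => << e (r' c) >>)).
- apply: linear_eq_basis => [||b]; [|exact: linear_id|].
    exact: linear_comp (linext_linear _) fL.
  rewrite -(model_reprK M b) fE // linext_basis (model_repr M') //.
  by rewrite (model_st M).
- apply: linear_eq_basis => [||c]; [|exact: linear_id|].
    exact: linear_comp fL (linext_linear _).
  by rewrite linext_basis fE // (model_reprK M').
Qed.

End Isomorphism.

End ForestModels.

(** * The tree model *)

Section TreeModel.

Variable k : fieldType.

(** [st_hotree] takes a proof that [F] is a heap forest, which [idP] recovers from the boolean;
    other sequences get the default [tree_e]. *)
Definition tree_of_forest (F : seq htree) : hotrees :=
  match @idP (heap_forest F) with
  | ReflectT hF => st_hotree hF
  | ReflectF _ => tree_e
  end.

(** The forest determines [n] as its number of labels, and proofs of a boolean are unique. *)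
Lemma eq_mk_hotree n n' F F' (h : std_forest n F) (h' : std_forest n' F') :
  F = F' -> mk_hotree h = mk_hotree h'.
Proof.
move=> eF; subst F'; have en : n = n'.
  have [/andP[_ p] /andP[_ p']] := (h, h').
  by rewrite -(size_iota 0 n) -(perm_size p) (perm_size p') size_iota.
by subst n'; rewrite (bool_irrelevance h h').
Qed.

Lemma tree_of_forestE F (hF : heap_forest F) : tree_of_forest F = st_hotree hF.
Proof.
rewrite /tree_of_forest; case: {-}_ / idP => // hF'.
by rewrite (bool_irrelevance hF hF').
Qed.

Lemma tree_of_std_forest n F (h : std_forest n F) : tree_of_forest F = mk_hotree h.
Proof.
have /andP[hF _] := h; rewrite (tree_of_forestE hF).
by apply: eq_mk_hotree; apply: st0_std h.
Qed.

Lemma tree_forest_model :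
  forest_model (kT k) tree_of_forest (fun t : hotrees => forest (tagged t)).
Proof.
split.
- by move=> y; apply: linext2_linearl.
- by move=> x; apply: linext2_linearr.
- exact: linext_linear.
- exact: (@linext_linear k _ k^o).
- by move=> t; apply: heap_forest_hotree.
- by case=> n [F h]; rewrite /= (tree_of_std_forest h).
- by move=> F hF; rewrite (tree_of_forestE hF).
- move=> m n F1 F2 h1 h2.
  rewrite (tree_of_std_forest h1) (tree_of_std_forest h2) /= linext2_basis /=.
  pose H ps : {malg k[hotrees]} := << tree_of_forest (attach_pairs ps F2) >>%R.
  (* These lengths are equal but not convertible; the final [case] transports the tuple type along
     this equality. *)
  have szF : size F1 = size (st F1 n) by rewrite size_map.
  rewrite -(big_choice_points n (st F1 n) H) /tree_mul /=.
  transitivity (\sum_(f : (size F1).-tuple (option 'I_n))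
    H (zip (st F1 n) (choice_points f)))%R.
    apply: eq_bigr => f _; congr << _ >>%R.
    exact/esym/tree_of_std_forest.
  by case: _ / szF.
- move=> n F h; rewrite (tree_of_std_forest h) /= linext_basis.
  rewrite -(big_masks F) /tree_comul /=; apply: eq_bigr => X _.
  by congr << (_, _) >>%R; apply/esym/tree_of_forestE.
- by congr << _ >>%R; apply/esym/tree_of_std_forest.
- move=> n F h; rewrite /= linext_basis (tree_of_std_forest h).
  congr ((nat_of_bool _)%:R)%R; apply/eqP/eqP => [|F0].
    by move/(congr1 (fun t : hotrees => forest (tagged t))).
  exact: eq_mk_hotree.
Qed.

End TreeModel.

(** * Permutations and their standard strings *)

Section CycleStrings.

Local Open Scope nat_scope.

Lemma uniq_flatten_mem (T : eqType) (ss : seq (seq T)) s : uniq (flatten ss) ->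
  s \in ss -> uniq s.
Proof.
elim: ss => //= u ss IH; rewrite cat_uniq inE => /and3P[uu _ uss].
by case/orP => [/eqP->|/IH]; last apply.
Qed.

Lemma uniq_flatten_map (T U : eqType) (A : seq T) (g : T -> seq U) : uniq A ->
  {in A, forall a, uniq (g a)} ->
  {in A &, forall a b y, y \in g a -> y \in g b -> a = b} ->
  uniq (flatten (map g A)).
Proof.
elim: A => //= a A IH /andP[aA uA] gu gd; rewrite cat_uniq.
rewrite gu ?mem_head //= IH //; first 1 last.
- by move=> b bA; apply: gu; rewrite inE bA orbT.
- by move=> b b' bA bA'; apply: gd; rewrite inE ?bA ?bA' orbT.
rewrite andbT; apply/hasPn => y /flatten_mapP[b bA yb]; apply/negP => /= ya.
move: aA; rewrite (gd a b _ _ y) ?bA ?mem_head //.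
by rewrite inE bA orbT.
Qed.

Lemma perm_flatten_rev (T : eqType) (ss : seq (seq T)) :
  perm_eq (flatten (rev ss)) (flatten ss).
Proof. by apply: perm_flatten; rewrite perm_rev. Qed.

Lemma map_pmap_ohead (T : eqType) U (g : T -> U) (h : seq T -> U) (c : seq (seq T)) :
  {in c, forall s, if s is a :: _ then g a = h s else False} ->
  map g (pmap ohead c) = map h c.
Proof.
elim: c => //= s c IH H; have Hc := IH (fun u uc => H u (mem_behead (s := s :: c) uc)).
by have := H s (mem_head _ _); case: s {H} => //= a s ->; rewrite Hc.
Qed.

(** * Products of disjoint cycles and orbits *)

Section Ordinals.

Variable n : nat.
Implicit Types (c : seq (seq 'I_n)) (s : seq 'I_n) (p : 'S_n).

Lemma perm_of_cycles_val c :
  perm_of_cycles n (map (map val) c) = (\prod_(s <- c) cycle_perm s)%g.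
Proof.
rewrite /perm_of_cycles big_map; apply: eq_bigr => s _.
by rewrite (map_pK (@valK _ _ _)).
Qed.

Lemma cycle_permE s x : uniq s -> cycle_perm s x = next s x.
Proof. by move=> us; rewrite permE undup_id. Qed.

Lemma prod_cycles_out c x : uniq (flatten c) -> x \notin flatten c ->
  (\prod_(s <- c) cycle_perm s)%g x = x.
Proof.
elim: c => [|s c IH] /=; first by rewrite big_nil perm1.
rewrite cat_uniq mem_cat negb_or => /and3P[us _ uc] /andP[xs xc].
by rewrite big_cons permM cycle_permE // next_nth (negbTE xs) IH.
Qed.

Lemma prod_cycles_in c s x : uniq (flatten c) -> s \in c -> x \in s ->
  (\prod_(s <- c) cycle_perm s)%g x = next s x.
Proof.
elim: c => //= u c IH; rewrite cat_uniq inE => /and3P[uu /hasPn uc1 uc].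
rewrite big_cons permM cycle_permE // => /orP[/eqP-> xu|sc xs].
  rewrite prod_cycles_out //; apply/negP => /uc1 /=.
  by rewrite mem_next xu.
rewrite [next u x]next_nth ifN ?IH //.
by apply: uc1; apply/flattenP; exists s.
Qed.

Lemma perm_prod_cycles c c' : uniq (flatten c) -> perm_eq c c' ->
  (\prod_(s <- c) cycle_perm s = \prod_(s <- c') cycle_perm s)%g.
Proof.
move=> uc pc; have uc' : uniq (flatten c') by rewrite -(perm_uniq (perm_flatten pc)).
apply/permP => x; have [/flattenP[s sc xs]|xc] := boolP (x \in flatten c).
  by rewrite !(@prod_cycles_in _ s) // -(perm_mem pc).
by rewrite !prod_cycles_out // -(perm_mem (perm_flatten pc)).
Qed.

Lemma porbit_fconnect p x y : (y \in porbit p x) = fconnect p x y.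
Proof.
apply/porbitP/idP => [[i ->]|/iter_findex <-].
  by rewrite permX fconnect_iter.
by exists (findex p x y); rewrite permX.
Qed.

Lemma porbit_fcycle p s x : fcycle p s -> x \in s -> porbit p x =i s.
Proof. by move=> ps xs y; rewrite porbit_fconnect (fconnect_cycle ps). Qed.

Lemma fcycle_traject p x : fcycle p (traject p x #|porbit p x|).
Proof.
case E: #|porbit p x| => [|m] //.
by rewrite (cycle_path x) /= last_traject fpath_traject andbT -iterS -E iter_porbit.
Qed.

(** A cycle of [p] is recovered from its first entry, the orbit providing its length. *)
Lemma traject_fcycle p a s : fcycle p (a :: s) -> uniq (a :: s) ->
  traject p a #|porbit p a| = a :: s.
Proof.
move=> ps us; rewrite (eq_card (porbit_fcycle ps (mem_head _ _))).
rewrite (card_uniqP us) /=; congr cons.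
move: ps; rewrite /= rcons_path => /andP[/fpathP[m ->] _].
by rewrite size_traject.
Qed.

Definition orbit_min p a := [forall b in porbit p a, a <= b].

Lemma orbit_min_inj p a b : orbit_min p a -> orbit_min p b ->
  a \in porbit p b -> a = b.
Proof.
move=> /forall_inP ma /forall_inP mb ab; apply/val_inj/eqP; rewrite eqn_leq.
by rewrite mb // ma // porbit_sym.
Qed.

Lemma exists_orbit_min p x : exists2 a, orbit_min p a & x \in porbit p a.
Proof.
case: (arg_minnP (P := fun y => y \in porbit p x) val (porbit_id p x)) => a ax amin.
exists a; last by rewrite porbit_sym.
apply/forall_inP => b; rewrite -(eqP (_ : porbit p a == porbit p x)) in amin * => //.
  by move=> ba; apply: amin.
by rewrite eq_porbit_mem.
Qed.

(** [std_cycles] before its entries become natural numbers, so that [p] can be applied to them. *)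
Definition ord_cycles p : seq (seq 'I_n) :=
  [seq traject p a #|porbit p a| | a <- rev (enum 'I_n) & orbit_min p a].

Lemma std_cycles_val p : std_cycles p = map (map val) (ord_cycles p).
Proof. by rewrite /std_cycles /ord_cycles -map_comp. Qed.

Lemma sorted_rev_enum : sorted gtn (map val (rev (enum 'I_n))).
Proof. by rewrite map_rev val_enum_ord rev_sorted iota_ltn_sorted. Qed.

Lemma uniq_ord_cycles p : uniq (flatten (ord_cycles p)).
Proof.
apply: uniq_flatten_map => [|a _|a b].
- by rewrite filter_uniq // rev_uniq enum_uniq.
- exact: uniq_traject_porbit.
rewrite !mem_filter => /andP[ma _] /andP[mb _] y.
rewrite -!porbit_traject => ya yb; apply: (orbit_min_inj ma mb).
by move: ya yb; rewrite -!eq_porbit_mem => /eqP <-.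
Qed.

Lemma mem_ord_cycles p x :
  exists2 a, traject p a #|porbit p a| \in ord_cycles p &
    x \in traject p a #|porbit p a|.
Proof.
have [a ma xa] := exists_orbit_min p x.
exists a; last by rewrite -porbit_traject.
by apply: map_f; rewrite mem_filter ma mem_rev mem_enum.
Qed.

Lemma prod_ord_cycles p : (\prod_(s <- ord_cycles p) cycle_perm s)%g = p.
Proof.
apply/permP => x; have [a ap xa] := mem_ord_cycles p x.
rewrite (prod_cycles_in (uniq_ord_cycles p) ap xa).
by apply/esym/eqP; apply: (next_cycle (fcycle_traject p a) xa).
Qed.

End Ordinals.

(** * Uniqueness of the standard form *)

Definition min_first (s : seq nat) := if s is x :: s' then all (ltn x) s' else false.

Definition standard_strings n (ss : seq (seq nat)) :=
  [&& perm_eq (flatten ss) (iota 0 n), all min_first ss &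
      sorted gtn (map (head 0) ss)].

Lemma strings_ord n (ss : seq (seq nat)) : all (gtn n) (flatten ss) ->
  exists c : seq (seq 'I_n), ss = map (map val) c.
Proof.
have ordS s : all (gtn n) s -> exists u : seq 'I_n, s = map val u.
  elim: s => [|x s IH] /=; first by exists [::].
  by case/andP => xn /IH[u ->]; exists (Ordinal xn :: u).
elim: ss => [|s ss IH] /=; first by exists [::].
by rewrite all_cat => /andP[/ordS[u ->] /IH[c ->]]; exists (u :: c).
Qed.

Lemma flatten_map_val n (c : seq (seq 'I_n)) :
  flatten (map (map val) c) = map val (flatten c).
Proof. by rewrite map_flatten. Qed.

Lemma perm_of_cycles_perm n ss ss' : uniq (flatten ss) -> all (gtn n) (flatten ss) ->
  perm_eq ss ss' -> perm_of_cycles n ss = perm_of_cycles n ss'.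
Proof.
move=> us ns pss; have ns' : all (gtn n) (flatten ss').
  by rewrite -(perm_all _ (perm_flatten pss)).
have [c Ec] := strings_ord ns; have [c' Ec'] := strings_ord ns'.
subst ss ss'; rewrite !perm_of_cycles_val; apply: perm_prod_cycles.
  by move: us; rewrite flatten_map_val (map_inj_uniq val_inj).
exact: (perm_map_inj (inj_map val_inj) pss).
Qed.

Lemma standard_std_cycles n (p : 'S_n) : standard_strings n (std_cycles p).
Proof.
rewrite std_cycles_val; apply/and3P; split.
- rewrite flatten_map_val; apply: uniq_perm; first 1 last.
  + exact: iota_uniq.
  + move=> x; rewrite mem_iota /=; apply/mapP/idP => [[y _ ->]|xn]; first exact: ltn_ord.
    exists (Ordinal xn) => //; have [a ap xa] := mem_ord_cycles p (Ordinal xn).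
    by apply/flattenP; exists (traject p a #|porbit p a|).
  by rewrite (map_inj_uniq val_inj) uniq_ord_cycles.
- apply/allP => _ /mapP[_ /mapP[a + ->] ->].
  rewrite mem_filter => /andP[/forall_inP ma _].
  have := uniq_traject_porbit p a; have := @porbit_traject _ p a.
  case: #|porbit p a| (card_porbit_neq0 p a) => // m _ pE /= /andP[ap _].
  apply/allP => _ /mapP[b bp ->]; rewrite /= ltn_neqAle ma; last first.
    by rewrite pE inE bp orbT.
  by rewrite andbT; apply: contraNneq ap => /val_inj ab; rewrite {1}ab.
- rewrite -map_comp /ord_cycles -map_comp.
  rewrite (eq_map (g := val)); last first.
    move=> a /=; case: #|porbit p a| (card_porbit_neq0 p a) => //.
  apply: (subseq_sorted _ _ (sorted_rev_enum n)); last first.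
    by apply: map_subseq; apply: filter_subseq.
  by move=> x y z /= xy yz; apply: ltn_trans yz xy.
Qed.

Lemma perm_of_std_cycles n (p : 'S_n) : perm_of_cycles n (std_cycles p) = p.
Proof. by rewrite std_cycles_val perm_of_cycles_val prod_ord_cycles. Qed.

Lemma standard_strings_uniq n ss : standard_strings n ss -> uniq (flatten ss).
Proof. by case/and3P=> /perm_uniq -> _ _; apply: iota_uniq. Qed.

Lemma standard_strings_lt n ss : standard_strings n ss -> all (gtn n) (flatten ss).
Proof.
case/and3P=> /perm_all -> _ _; apply/allP => x.
by rewrite mem_iota.
Qed.

(** In both lists each string is the trajectory of its first entry, and the first entries are the
    minima of the orbits. Strictly decreasing lists with the same members are equal. *)
Lemma std_cycles_of n ss : standard_strings n ss ->
  std_cycles (perm_of_cycles n ss) = ss.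
Proof.
move=> sS; have us := standard_strings_uniq sS.
have [c Ec] := strings_ord (standard_strings_lt sS).
case/and3P: sS => pS mS hS; subst ss.
rewrite perm_of_cycles_val std_cycles_val; congr map.
rewrite flatten_map_val (map_inj_uniq val_inj) in us.
set p := (\prod_(s <- c) _)%g.
have cov x : x \in flatten c.
  rewrite -(mem_map val_inj) -flatten_map_val (perm_mem pS) mem_iota /=.
  exact: ltn_ord.
have pc s : s \in c -> fcycle p s.
  move=> sc; apply: cycle_from_next => [|x xs]; first exact: uniq_flatten_mem us sc.
  by rewrite /= (prod_cycles_in us sc xs).
have mc s : s \in c -> min_first (map val s) by move=> sc; apply/(allP mS)/map_f.
have cE : map (fun a => traject p a #|porbit p a|) (pmap ohead c) = c.
  rewrite -[RHS]map_id; apply: map_pmap_ohead => -[|a s] sc.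
    by have := mc _ sc.
  by rewrite (traject_fcycle (pc _ sc)) // (uniq_flatten_mem us sc).
rewrite -[RHS]cE /ord_cycles; congr map.
have gt_trans : transitive gtn by move=> x y z /= xy yz; apply: ltn_trans yz xy.
apply: (inj_map val_inj); apply: (irr_sorted_eq gt_trans) => [x| | |x].
- by rewrite /= ltnn.
- apply: (subseq_sorted gt_trans _ (sorted_rev_enum n)).
  by apply: map_subseq; apply: filter_subseq.
- rewrite (_ : map val _ = map (head 0) (map (map val) c)) //.
  rewrite -map_comp; apply: map_pmap_ohead => -[|a s] sc //.
  by have := mc _ sc.
(* Conversely, an orbit minimum lies in some string, whose first entry is a minimum of the same
   orbit. *)
have headE a : a \in pmap ohead c = orbit_min p a.
  apply/idP/idP => [|ma].
    rewrite mem_pmap => /mapP[[|b s] sc] //= [->]; apply/forall_inP => y.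
    rewrite (porbit_fcycle (pc _ sc) (mem_head _ _)) inE => /orP[/eqP-> //|ys].
    by apply/ltnW/(allP (mc _ sc))/map_f.
  have /flattenP[[|b s] sc as_] // := cov a.
  have ab : a = b.
    apply: (orbit_min_inj ma); last first.
      by rewrite (porbit_fcycle (pc _ sc) (mem_head _ _)).
    apply/forall_inP => y.
    rewrite (porbit_fcycle (pc _ sc) (mem_head _ _)) inE => /orP[/eqP-> //|ys].
    by apply/ltnW/(allP (mc _ sc))/map_f.
  by rewrite ab mem_pmap; apply/mapP; exists (b :: s).
apply/mapP/mapP => -[a ha ->]; exists a => //.
  by rewrite headE; move: ha; rewrite mem_filter => /andP[].
by rewrite mem_filter -headE ha mem_rev mem_enum.
Qed.

End CycleStrings.

(** * Trees and strings *)

Section AlphaStrings.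

Local Open Scope nat_scope.

Implicit Types (t : htree) (F : seq htree).

Lemma perm_alpha t : perm_eq (alpha t) (labels t).
Proof.
elim/htree_mem_ind: t => i ts IH /=; rewrite perm_cons.
rewrite (perm_trans (perm_flatten_rev _)) //.
elim: ts IH => //= t ts IHts IH; apply: perm_cat; first exact/IH/mem_head.
by apply: IHts => u uts; apply: IH; rewrite inE uts orbT.
Qed.

Lemma perm_flatten_alpha F : perm_eq (flatten (map alpha F)) (flabels F).
Proof. by elim: F => //= t F IH; apply: perm_cat => //; apply: perm_alpha. Qed.

Lemma alpha_relabel f t : alpha (relabel f t) = map f (alpha t).
Proof.
elim/htree_mem_ind: t => i ts IH /=; congr cons.
rewrite map_flatten map_rev -!map_comp; congr (flatten (rev _)).
exact/eq_in_map.
Qed.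

Lemma head_alpha t : head 0 (alpha t) = root t.
Proof. by case: t. Qed.

Lemma heap_labels_gt i ts : heap (HNode i ts) -> all (ltn i) (flabels ts).
Proof.
suff H t : heap t -> forall i ts, t = HNode i ts -> all (ltn i) (flabels ts).
  by move=> h; apply: H h _ _ erefl.
elim/htree_mem_ind: t {i ts} => i ts IH /= /and3P[gt_ts _ h_ts] _ _ [<- <-].
apply/allP => x /flattenP[_ /mapP[[j us] tin ->]] /=.
have ij : i < j := allP gt_ts _ tin.
rewrite inE => /orP[/eqP->//|xus]; apply: ltn_trans ij _.
exact: (allP (IH _ tin (allP h_ts _ tin) _ _ erefl)).
Qed.

Lemma min_first_alpha t : heap t -> min_first (alpha t).
Proof.
case: t => i ts /heap_labels_gt h /=.
rewrite (perm_all _ (perm_flatten_rev _)).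
by rewrite (perm_all _ (perm_flatten_alpha _)).
Qed.

(** Siblings increase while standard order has decreasing first entries, whence the reversal. *)
Lemma standard_alpha n F : std_forest n F -> standard_strings n (rev (map alpha F)).
Proof.
case/andP=> /and3P[sF hF uF] pF; apply/and3P; split.
- apply: (perm_trans (perm_flatten_rev _)).
  exact: perm_trans (perm_flatten_alpha F) pF.
- rewrite all_rev; apply/allP => _ /mapP[t tF ->].
  exact/min_first_alpha/(allP hF).
- rewrite map_rev rev_sorted -map_comp (eq_map (g := root)) // => t.
  exact: head_alpha.
Qed.

(* Reading a string from right to left, each entry becomes the parent of the
   trees obtained so far whose roots are larger. *)
Definition parse_step (x : nat) (F : seq htree) : seq htree :=
  HNode x (rev [seq t <- F | x < root t]) :: [seq t <- F | root t < x].

Definition parse (s : seq nat) : seq htree := foldr parse_step [::] s.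

Lemma parse_cons x s : parse (x :: s) = parse_step x (parse s).
Proof. by []. Qed.

(** No entry of [alpha t] adopts a tree of [parse s]: those roots are smaller than [root t], the
    least label of [t]. *)
Lemma parse_alpha_cat t s : heap t -> all (fun u => root u < root t) (parse s) ->
  parse (alpha t ++ s) = t :: parse s.
Proof.
elim/htree_mem_ind: t s => i ts IH s /and3P[gt_ts s_ts h_ts] lt_s.
rewrite [alpha _]/= cat_cons parse_cons.
have sorted_rev : sorted gtn (map root (rev ts)) by rewrite map_rev rev_sorted.
(* The string of each child is followed only by trees with smaller roots, so the induction
   hypothesis applies to it. *)
have -> : parse (flatten (rev (map alpha ts)) ++ s) = rev ts ++ parse s.
  rewrite -map_rev; have: {subset rev ts <= ts} by move=> u; rewrite mem_rev.
  elim: (rev ts) sorted_rev => //= u us IHus suus sub.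
  have uts : u \in ts by apply: sub; rewrite mem_head.
  have sub' : {subset us <= ts} by move=> v vus; apply: sub; rewrite inE vus orbT.
  have E := IHus (path_sorted suus) sub'.
  have lt_u : all (fun v => root v < root u) (us ++ parse s).
    have gt_trans : transitive gtn by move=> x y z /= xy yz; apply: ltn_trans yz xy.
    rewrite all_cat; apply/andP; split.
      by have := order_path_min gt_trans suus; rewrite all_map.
    apply/allP => v vs; apply: ltn_trans (allP lt_s _ vs) _.
    exact: (allP gt_ts).
  rewrite -E in lt_u; by rewrite -catA (IH _ uts _ (allP h_ts _ uts) lt_u) E.
rewrite /parse_step !filter_cat.
have gtE : [seq t <- rev ts | i < root t] = rev ts.
  by apply/all_filterP; rewrite all_rev.
have gtN : [seq t <- rev ts | root t < i] = [::].
  apply/eqP; rewrite -[_ == _]negbK -has_filter; apply/hasPn => t.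
  by rewrite mem_rev => /(allP gt_ts) /= it; rewrite -leqNgt ltnW.
have ltE : [seq t <- parse s | root t < i] = parse s by apply/all_filterP.
have ltN : [seq t <- parse s | i < root t] = [::].
  apply/eqP; rewrite -[_ == _]negbK -has_filter; apply/hasPn => t.
  by move=> /(allP lt_s) /= it; rewrite -leqNgt ltnW.
by rewrite gtE gtN ltE ltN cats0 revK.
Qed.

Lemma parse_alpha F : sorted ltn (map root F) -> all heap F ->
  parse (flatten (rev (map alpha F))) = rev F.
Proof.
move=> sF hF; have : sorted gtn (map root (rev F)) by rewrite map_rev rev_sorted.
rewrite -map_rev; have : all heap (rev F) by rewrite all_rev.
elim: (rev F) => //= u us IH /andP[hu hus] suus.
have E := IH hus (path_sorted suus).
rewrite parse_alpha_cat ?E //.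
have gt_trans : transitive gtn by move=> x y z /= xy yz; apply: ltn_trans yz xy.
by have := order_path_min gt_trans suus; rewrite all_map.
Qed.

Lemma parse_sorted s : sorted gtn (map root (parse s)).
Proof.
have gt_trans : transitive gtn by move=> x y z /= xy yz; apply: ltn_trans yz xy.
elim: s => //= x s IH; rewrite (path_sortedE gt_trans); apply/andP; split.
  by rewrite all_map; apply: filter_all.
by apply: (subseq_sorted gt_trans _ IH); apply/map_subseq/filter_subseq.
Qed.

Lemma parse_heap s : all heap (parse s).
Proof.
elim: s => //= x s IH; apply/andP; split; last first.
  by apply/allP => t; rewrite mem_filter => /andP[_ /(allP IH)].
apply/and3P; split.
- by rewrite all_rev filter_all.
- rewrite map_rev rev_sorted.
  apply: (subseq_sorted _ _ (parse_sorted s)); last exact/map_subseq/filter_subseq.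
  by move=> u v w /= uv vw; apply: ltn_trans vw uv.
- by rewrite all_rev; apply/allP => t; rewrite mem_filter => /andP[_ /(allP IH)].
Qed.

Lemma parse_roots s : {subset map root (parse s) <= s}.
Proof.
elim: s => //= x s IH y; rewrite !inE => /orP[->//|/mapP[t]].
by rewrite mem_filter => /andP[_ ts] ->; rewrite IH ?orbT ?map_f.
Qed.

(** When roots decrease, those above [x] come first; hence [parse_step] loses no tree and keeps
    their order. *)
Lemma filter_roots_split x F : sorted gtn (map root F) -> x \notin map root F ->
  [seq t <- F | x < root t] ++ [seq t <- F | root t < x] = F.
Proof.
have gt_trans : transitive gtn by move=> u v w /= uv vw; apply: ltn_trans vw uv.
elim: F => //= t F IH stF; rewrite inE negb_or => /andP[xt xF].
case: (ltngtP x (root t)) xt => // xt _.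
  by rewrite cat_cons IH // (path_sorted stF).
have tF := order_path_min gt_trans stF.
have -> : [seq t <- F | x < root t] = [::].
  apply/eqP; rewrite -[_ == _]negbK -has_filter; apply/hasPn => u uF.
  rewrite -leqNgt ltnW // (ltn_trans _ xt) //.
  by apply: (allP tF); apply: map_f.
congr cons; apply/all_filterP/allP => u uF /=; apply: ltn_trans xt.
by apply: (allP tF); apply: map_f.
Qed.

Lemma alpha_parse s : uniq s -> flatten (map alpha (parse s)) = s.
Proof.
elim: s => //= x s IH /andP[xs us]; congr cons.
rewrite map_rev revK -flatten_cat -map_cat filter_roots_split ?IH //.
  exact: parse_sorted.
by apply: contra xs; apply: parse_roots.
Qed.

(** No entry of [s] can become the parent of a tree of [parse s']. *)
Lemma parse_cat s s' : {in s, forall x, all (fun t => root t < x) (parse s')} ->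
  parse (s ++ s') = parse s ++ parse s'.
Proof.
elim: s => //= x s IH lt; rewrite IH; last first.
  by move=> y ys; apply: lt; rewrite inE ys orbT.
have ltx := lt x (mem_head _ _).
have ltN : [seq t <- parse s' | x < root t] = [::].
  apply/eqP; rewrite -[_ == _]negbK -has_filter; apply/hasPn => t.
  by move=> /(allP ltx) /= it; rewrite -leqNgt ltnW.
by rewrite /parse_step !filter_cat ltN cats0 (all_filterP ltx).
Qed.

(** The least entry stands first and adopts every tree found to its right. *)
Lemma parse_min_first x s : all (ltn x) s -> uniq (x :: s) ->
  exists2 t, parse (x :: s) = [:: t] & alpha t = x :: s /\ root t = x.
Proof.
move=> xs /= /andP[_ us].
have gtx : all (fun t => x < root t) (parse s).
  by apply/allP => t ts; apply/(allP xs)/parse_roots/map_f.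
exists (HNode x (rev (parse s))); last by rewrite /= map_rev revK alpha_parse.
rewrite /parse_step (all_filterP gtx) (_ : [seq t <- _ | _] = [::]) //.
apply/eqP; rewrite -[_ == _]negbK -has_filter; apply/hasPn => t.
by move=> /(allP gtx) /= it; rewrite -leqNgt ltnW.
Qed.

(** Erasing the parentheses of a standard form loses nothing: as in Foata's correspondence, the
    first entries are the left-to-right minima of the concatenation. The induction carries the roots
    along, to compare a string with the trees behind it. *)
Lemma map_alpha_parse (ss : seq (seq nat)) : all min_first ss ->
  sorted gtn (map (head 0) ss) -> uniq (flatten ss) ->
  map alpha (parse (flatten ss)) = ss.
Proof.
have gt_trans : transitive gtn by move=> u v w /= uv vw; apply: ltn_trans vw uv.
move=> mS hS uS.
suff [] : map alpha (parse (flatten ss)) = ss /\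
          map root (parse (flatten ss)) = map (head 0) ss by [].
elim: ss mS hS uS => // -[|x s] ss IH // /andP[xs mS] hS.
rewrite [uniq _]/= mem_cat negb_or cat_uniq => /andP[/andP[xs' _] /and3P[us _ uS]].
have [E1 E2] := IH mS (path_sorted hS) uS.
have uxs : uniq (x :: s) by rewrite /= xs'.
have [t Et [at_ rt]] := parse_min_first xs uxs.
have lt_x : all (fun t => root t < x) (parse (flatten ss)).
  have := order_path_min gt_trans (hS : path gtn x (map (head 0) ss)).
  by rewrite -E2 all_map.
have E : parse ((x :: s) ++ flatten ss) = t :: parse (flatten ss).
  rewrite parse_cat ?Et // => y ys; apply/allP => u /(allP lt_x) /=.
  move: ys; rewrite inE => /orP[/eqP-> //|/(allP xs) /= xy ux].
  exact: ltn_trans ux xy.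
by rewrite -[flatten (_ :: ss)]/((x :: s) ++ flatten ss) E /= at_ rt E1 E2.
Qed.

Lemma flatten_map_flatten (T U : Type) (g : T -> seq U) (ss : seq (seq T)) :
  flatten (map g (flatten ss)) = flatten [seq flatten (map g s) | s <- ss].
Proof. by elim: ss => //= s ss IH; rewrite map_cat flatten_cat IH. Qed.

(* The children grafted at [a] carry the largest labels, so that their strings
   are inserted directly to the right of [a], in decreasing order. *)
Lemma alpha_graft N t : alpha (graft N t) =
  flatten [seq a :: flatten (rev (map alpha (N a))) | a <- alpha t].
Proof.
elim/htree_mem_ind: t => i ts IH /=; congr cons.
rewrite map_cat rev_cat flatten_cat; congr (_ ++ _).
rewrite flatten_map_flatten map_rev -!map_comp; congr (flatten (rev _)).
exact/eq_in_map.
Qed.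

End AlphaStrings.

(** * The permutation model *)

Section PermModel.

Local Open Scope nat_scope.

Definition perm_of_forest (F : seq htree) : perms := st_cycles (map alpha F).

(** Standard order puts the largest first entry in front; [rev] restores increasing siblings. *)
Definition forest_of_perm (p : perms) : seq htree :=
  rev (parse (flatten (std_cycles (tagged p)))).

Lemma eq_mk_perm n n' ss : n = n' ->
  mk_perm (perm_of_cycles n ss) = mk_perm (perm_of_cycles n' ss).
Proof. by move->. Qed.

Lemma perm_of_forestE F : perm_of_forest F =
  mk_perm (perm_of_cycles (size (flabels F)) (map alpha (st F 0))).
Proof.
rewrite /perm_of_forest /st_cycles (eq_mk_perm _ (perm_size (perm_flatten_alpha F))).
congr (mk_perm (perm_of_cycles _ _)); rewrite -!map_comp; apply: eq_map => t /=.
rewrite alpha_relabel; apply: eq_map => j.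
by rewrite addn0 (perm_rank (perm_flatten_alpha F)).
Qed.

Lemma size_std_forest n F : std_forest n F -> size (flabels F) = n.
Proof. by case/andP=> _ /perm_size ->; rewrite size_iota. Qed.

Lemma perm_of_std_forest n F : std_forest n F ->
  perm_of_forest F = mk_perm (perm_of_cycles n (map alpha F)).
Proof.
move=> h; rewrite perm_of_forestE (st0_std h); apply: eq_mk_perm.
exact: size_std_forest.
Qed.

Lemma std_cycles_alpha n F : std_forest n F ->
  std_cycles (perm_of_cycles n (map alpha F)) = rev (map alpha F).
Proof.
move=> /standard_alpha sF; rewrite -[RHS](std_cycles_of sF); congr std_cycles.
apply/esym; apply: perm_of_cycles_perm; last by rewrite perm_rev.
  exact: standard_strings_uniq sF.
exact: standard_strings_lt sF.
Qed.

Lemma std_forest_of_perm n (p : 'S_n) : std_forest n (forest_of_perm (mk_perm p)).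
Proof.
have sp := standard_std_cycles p; have us := standard_strings_uniq sp.
rewrite /forest_of_perm /=; set u := parse _.
have pl : perm_eq (flabels (rev u)) (iota 0 n).
  apply: perm_trans (flabels_perm _) _; first by rewrite perm_rev.
  rewrite perm_sym (perm_trans _ (perm_flatten_alpha u)) // alpha_parse //.
  by rewrite perm_sym; case/and3P: sp.
rewrite /std_forest pl andbT; apply/and3P; split.
- by rewrite map_rev rev_sorted parse_sorted.
- by rewrite all_rev parse_heap.
- by rewrite (perm_uniq pl) iota_uniq.
Qed.

Lemma forest_of_permK : cancel forest_of_perm perm_of_forest.
Proof.
case=> n p; rewrite (perm_of_std_forest (std_forest_of_perm p)) /forest_of_perm /=.
have sp := standard_std_cycles p; have us := standard_strings_uniq sp.
have /and3P[_ mS hS] := sp.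
rewrite map_rev map_alpha_parse //; congr mk_perm.
rewrite -[RHS]perm_of_std_cycles; apply/esym/perm_of_cycles_perm => //.
  exact: standard_strings_lt sp.
by rewrite perm_sym perm_rev.
Qed.

Lemma perm_of_forestK F : heap_forest F -> forest_of_perm (perm_of_forest F) = st F 0.
Proof.
move=> hF; rewrite perm_of_forestE /forest_of_perm /=.
have sF := std_forest_st hF; rewrite (std_cycles_alpha sF).
case/andP: sF => /and3P[sF hS _] _.
by rewrite parse_alpha // revK.
Qed.

(** Disjoint cycles commute. The coproduct splits the strings in standard order, the reverse of the
    order of the trees. *)
Lemma st_cycles_rev ss : uniq (flatten ss) -> st_cycles (rev ss) = st_cycles ss.
Proof.
move=> us; rewrite /st_cycles.
rewrite (eq_mk_perm _ (perm_size (perm_flatten_rev ss))); congr mk_perm.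
rewrite (eq_map (g := map (rank (flatten ss)))); last first.
  by move=> s; apply: eq_map; apply/perm_rank/perm_flatten_rev.
have pr : perm_eq (flatten [seq map (rank (flatten ss)) s | s <- ss])
    (iota 0 (size (flatten ss))).
  by rewrite -map_flatten; apply: rank_perm_iota.
apply/esym/perm_of_cycles_perm.
- by rewrite (perm_uniq pr) iota_uniq.
- by rewrite (perm_all _ pr); apply/allP => x; rewrite mem_iota.
- by rewrite map_rev perm_sym perm_rev.
Qed.

Lemma place_rev (T : Type) (ps : seq (T * option nat)) o :
  place (rev ps) o = rev (place ps o).
Proof. by rewrite /place filter_rev map_rev. Qed.

Variable k : fieldType.

Lemma perm_forest_model : forest_model (kS k) perm_of_forest forest_of_perm.
Proof.
split.
- by move=> y; apply: linext2_linearl.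
- by move=> x; apply: linext2_linearr.
- exact: linext_linear.
- exact: (@linext_linear k _ k^o).
- by case=> n p; have /andP[] := std_forest_of_perm p.
- exact: forest_of_permK.
- exact: perm_of_forestK.
- move=> m n F1 F2 h1 h2.
  rewrite (perm_of_std_forest h1) (perm_of_std_forest h2) /= linext2_basis /=.
  rewrite /heap_mul (std_cycles_alpha h2).
  set ss := map _ (std_cycles _).
  pose H (ps : seq (seq nat * option nat)) : {malg k[perms]} :=
    << mk_perm (perm_of_cycles (m + n)
      ([seq flatten [seq a :: flatten (place ps (Some a)) | a <- s]
       | s <- rev (map alpha F2)] ++ place ps None)) >>%R.
  rewrite [LHS](big_choice_points n ss H) /ss (std_cycles_alpha h1).
  have -> : [seq [seq n + i | i <- c] | c <- rev (map alpha F1)] =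
      rev (map alpha (st F1 n)).
    rewrite (st_std n h1) map_rev -!map_comp; congr rev; apply: eq_map => t /=.
    by rewrite alpha_relabel.
  (* Reversing the list of strings reverses each group placed at one point, which matches the
     reversed children in [alpha]. *)
  rewrite assign_sum_rev assign_sum_map; apply: eq_assign_sum => ps ps1 ps2.
  have [hF1 /andP[hF2 p2]] : heap_forest F1 /\ std_forest n F2 by case/andP: h1.
  have ps2' : {subset unzip2 ps <= None :: map Some (flabels F2)}.
    move=> o /ps2; rewrite !inE => /orP[->//|/mapP[a aF ->]].
    by rewrite map_f ?orbT // (perm_mem p2).
  have u2 : uniq (flabels F2) by case/and3P: hF2.
  have pS := flabels_st n h1; have pA := flabels_attach u2 ps2'.
  have hA : std_forest (m + n) (attach_pairs ps F2).
    apply/andP; split.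
      apply: (@heap_forest_attach n); rewrite ?ps1 //; first exact: heap_forest_st.
        by rewrite (perm_all _ p2); apply/allP => x; rewrite mem_iota.
      by rewrite (perm_all _ pS); apply/allP => x; rewrite mem_iota => /andP[].
    rewrite (perm_trans pA) // ps1 addnC iotaD add0n perm_catC.
    exact: perm_cat.
  rewrite (perm_of_std_forest hA) /H; congr << mk_perm _ >>%R.
  have sA := standard_alpha hA.
  have pE : perm_eq (rev (map alpha (attach_pairs ps F2))) (map alpha (attach_pairs ps F2)).
    by rewrite perm_rev.
  (* The order of the cycles does not affect the permutation, and for the reversed list
     [standard_alpha] supplies the side conditions. *)
  rewrite -(perm_of_cycles_perm _ _ pE); first 1 last.
  - exact: standard_strings_uniq sA.
  - exact: standard_strings_lt sA.
  apply/esym/perm_of_cycles_perm.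
  - exact: standard_strings_uniq sA.
  - exact: standard_strings_lt sA.
  rewrite perm_rev /attach_pairs map_cat; apply: perm_cat; last first.
    by rewrite place_rev place_map perm_sym perm_rev.
  rewrite map_rev perm_sym perm_rev -!map_comp.
  apply/seq.permP => P; congr (count P); apply: eq_map => t /=.
  rewrite alpha_graft; congr flatten; apply: eq_map => a.
  by rewrite place_rev place_map.
- move=> n F h; rewrite (perm_of_std_forest h) /= linext_basis /= /perm_comul.
  rewrite [LHS](big_masks _ (fun X Y => << (st_cycles X, st_cycles Y) >>%R)).
  rewrite (std_cycles_alpha h) split_sum_rev split_sum_map.
  have /andP[/and3P[_ _ uF] _] := h.
  have uX X : subseq X F -> uniq (flatten (map alpha X)).
    move=> /subseq_flabels sX; rewrite (perm_uniq (perm_flatten_alpha X)).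
    exact: subseq_uniq sX uF.
  by apply: eq_split_sum => X Y /uX uX' /uX uY _; rewrite !st_cycles_rev.
- congr << _ >>%R; rewrite /perm_of_forest /st_cycles /=.
  by rewrite /perm_of_cycles big_nil.
- move=> n F h; rewrite /= linext_basis perm_of_forestE /=.
  by rewrite size_eq0 flabels_eq_nil.
Qed.

(** [phi] applies [alpha] to the standardised trees, which is exactly the form given by
    [perm_of_forestE]. *)
Lemma phi_tree_of_forest F : heap_forest F ->
  phi k << tree_of_forest F >>%R = << perm_of_forest F >>%R.
Proof.
by move=> hF; rewrite /phi linext_basis (tree_of_forestE hF) perm_of_forestE.
Qed.

End PermModel.

Theorem mainTheorem2 (k : fieldType) :
  [/\ is_bialgebra (kS k), is_hopf (kS k)
    & is_bialg_isomorphism (kT k) (kS k) (phi k)].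
Proof.
split.
- exact: model_bialgebra (perm_forest_model k).
- exact: model_hopf (perm_forest_model k).
apply: (model_isomorphism (tree_forest_model k) (perm_forest_model k)).
  exact: linext_linear.
exact: phi_tree_of_forest.
Qed.
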